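(* Let $G=(V,E)$ be a Gaussian tree, let $a\ne c$ be two vertices of $G$, and let $Z_1,Z_2\subseteq V\setminus\{a,c\}$ be such that for each vertex $z_2\in Z_2$, both the path in $G$ joining $a$ and $z_2$ and the path in $G$ joining $c$ and $z_2$ (endpoints included) intersect $Z_1$. Then $$\rho^2_{ac\mid Z_1}\le\rho^2_{ac\mid Z_2}.$$
   Context: A Gaussian tree is a finite undirected tree $G=(V,E)$ together with a Gaussian random vector indexed by $V$ (also denoted $V$), $V\sim N(\mu,\Sigma)$ with $\Sigma$ positive definite, such that for pairwise disjoint $T_1,T_2,T_3\subseteq V$, $T_1$ and $T_2$ are conditionally independent given $T_3$ whenever $T_3$ separates $T_1$ from $T_2$ in $G$, i.e. every path from a vertex of $T_1$ to a vertex of $T_2$ intersects $T_3$. (The converse is not assumed.) For distinct $u,v$ and $Z\subseteq V\setminus\{u,v\}$ the squared partial correlation is $$\rho^2_{uv\mid Z}=\frac{(\sigma_{uv}-\Sigma_{uZ}\Sigma_{ZZ}^{-1}\Sigma_{Zv})^2}{(\sigma_{uu}-\Sigma_{uZ}\Sigma_{ZZ}^{-1}\Sigma_{Zu})(\sigma_{vv}-\Sigma_{vZ}\Sigma_{ZZ}^{-1}\Sigma_{Zv})},$$ where $\sigma_{uv}$ is the $(u,v)$ entry of $\Sigma$ and $\Sigma_{uZ}$ etc. are submatrices; for $Z=\emptyset$ the correction terms are absent. *)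

(* Defs.v *)
From HB Require Import structures.
From mathcomp Require Import all_boot all_order all_algebra.
From mathcomp Require Import all_classical all_reals all_analysis.

Set Implicit Arguments.
Unset Strict Implicit.
Unset Printing Implicit Defensive.

Import Order.TTheory GRing.Theory Num.Theory.
Import numFieldNormedType.Exports.

Local Open Scope classical_set_scope.
Local Open Scope ring_scope.

(* The size bound rules out the closed walk [:: x; y], which is a [ucycle] for
   every edge of a symmetric relation. *)
Definition acyclic_graph (V : finType) (e : rel V) : Prop :=
  forall c : seq V, ucycle e c -> (size c <= 2)%N.

Definition is_tree (V : finType) (e : rel V) : Prop :=
  [/\ symmetric e, irreflexive e, forall x y, connect e x y
    & acyclic_graph e].

(* The vertices of the path are those of [x :: p]. *)
Definition simple_path (V : finType) (e : rel V) (x y : V) (p : seq V) : Prop :=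
  [/\ path e x p, uniq (x :: p) & last x p = y].

Definition path_meets (V : finType) (e : rel V) (Z : {set V}) (x y : V) : Prop :=
  forall p, simple_path e x y p -> exists2 z, z \in x :: p & z \in Z.

Definition separates (V : finType) (e : rel V) (T1 T2 T3 : {set V}) : Prop :=
  forall x y, x \in T1 -> y \in T2 -> path_meets e T3 x y.

Section CovarianceMatrix.
Context {R : realType} {V : finType}.
Implicit Types (Sigma : V -> V -> R) (Z : {set V}) (u v : V).

Definition quad_form Sigma (t : V -> R) : R :=
  \sum_u \sum_v t u * Sigma u v * t v.

Definition posdef Sigma : Prop :=
  (forall u v, Sigma u v = Sigma v u) /\
  (forall t : V -> R, (exists v, t v != 0) -> 0 < quad_form Sigma t).

Definition sub_cov Sigma Z : 'M[R]_#|Z| :=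
  \matrix_(i, j) Sigma (enum_val i) (enum_val j).

Definition row_cov Sigma u Z : 'rV[R]_#|Z| := \row_j Sigma u (enum_val j).

Definition col_cov Sigma Z v : 'cV[R]_#|Z| := \col_i Sigma (enum_val i) v.

(* For Z = set0 the product runs through a 0-dimensional space, so the
   correction term is 0. *)
Definition partial_cov Sigma Z u v : R :=
  Sigma u v
  - (row_cov Sigma u Z *m invmx (sub_cov Sigma Z) *m col_cov Sigma Z v) 0 0.

Definition sq_partial_corr Sigma u v Z : R :=
  partial_cov Sigma Z u v ^+ 2
  / (partial_cov Sigma Z u u * partial_cov Sigma Z v v).

End CovarianceMatrix.

Section RandomVector.
Context {d : measure_display} {Omega : measurableType d} {R : realType}.
Variable P : probability Omega R.
Implicit Types (G : set (set Omega)) (A B : set Omega).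

(* X ~ N(mu, Sigma) for positive definite Sigma: every nonzero linear
   combination t.X has law N(t.mu, t^T Sigma t).  The second parameter of
   [normal_prob] is the standard deviation. *)
Definition gaussian_vector (V : finType) (X : V -> {RV P >-> R})
    (mu : V -> R) (Sigma : V -> V -> R) : Prop :=
  forall t : V -> R, (exists v, t v != 0) ->
  forall B : set R, measurable B ->
  P ((fun w => \sum_v t v * X v w) @^-1` B)
  = normal_prob (\sum_v t v * mu v) (Num.sqrt (quad_form Sigma t)) B.

(* The sigma-algebra on Omega generated by the subvector (X v), v in T. *)
Definition sigma_sub (V : finType) (X : V -> {RV P >-> R}) (T : {set V}) :
    set (set Omega) :=
  <<s \bigcup_(v in [set v | v \in T])
        preimage_set_system setT (X v) measurable >>.

(* f is a version of the conditional probability P(A | G). *)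
Definition cond_prob G A (f : Omega -> R) : Prop :=
  [/\ forall B : set R, measurable B -> G (f @^-1` B),
      P.-integrable setT (EFin \o f)
    & forall C, G C -> (\int[P]_(w in C) (f w)%:E = P (A `&` C))%E].

(* P(A `&` B | G) = P(A | G) P(B | G) a.s. for all A in G1, B in G2.  Versions
   exist and are a.s. unique, so it does not matter which ones are used. *)
Definition cond_indep (G1 G2 G : set (set Omega)) : Prop :=
  forall A B, G1 A -> G2 B ->
  exists f g h : Omega -> R,
    [/\ cond_prob G A f, cond_prob G B g, cond_prob G (A `&` B) h
      & {ae P, forall w, h w = f w * g w}].

Record gaussian_tree (V : finType) (e : rel V) (X : V -> {RV P >-> R})
    (mu : V -> R) (Sigma : V -> V -> R) : Prop := GaussianTree {
  gt_tree : is_tree e;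
  gt_posdef : posdef Sigma;
  gt_gaussian : gaussian_vector X mu Sigma;
  gt_markov : forall T1 T2 T3 : {set V},
    T1 :&: T2 = finset.set0 -> T1 :&: T3 = finset.set0 ->
    T2 :&: T3 = finset.set0 ->
    separates e T1 T2 T3 ->
    cond_indep (sigma_sub X T1) (sigma_sub X T2) (sigma_sub X T3)
}.

End RandomVector.

(* Main.v *)
(* The Markov property makes the partial covariance of u and v given Z vanish
   when Z separates u from v.  Indeed, let D be the centered residual of the
   linear regression of X_v on X_Z.  Since D is uncorrelated with every
   S in the span of X_Z, the variables S + tD and S - tD have the same normal
   law (up to the means), whence E[sin(tD) cos S] = E[sin(tD) sin S] = 0, then
   E[D cos S] = E[D sin S] = 0 for t -> 0.  As sines and cosines of S generate
   the sigma-algebra of X_Z, this gives E[D; C] = 0 for all C in it, so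
   conditional independence yields E[D X_u] = 0, which is a positive multiple of
   the partial covariance.

   Adding to Z1 the vertices of Z2, which are separated from a and c, does not
   change the partial correlation of a and c; and adding any vertex z to a
   conditioning set Z can only decrease it.  For the latter, let b be the vertex
   of the path from a to c nearest to z.  As b separates a, c and z pairwise,
   their correlations given Z factor through b as xy, xw, yw, and the claim
   follows from (1 - w^2)^2 <= (1 - x^2 w^2) (1 - y^2 w^2). *)

Require Import Defs.
From HB Require Import structures.
From mathcomp Require Import all_boot all_order all_algebra.
From mathcomp Require Import all_classical all_reals all_analysis.
From mathcomp Require Import measurable_realfun.
From mathcomp Require Import ring lra.

Set Implicit Arguments.
Unset Strict Implicit.
Unset Printing Implicit Defensive.

Import Order.TTheory GRing.Theory Num.Theory.
Import numFieldNormedType.Exports.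

Local Open Scope ring_scope.

(** * Partial covariances *)

Section PartialCovariance.
Context {R : realType} {V : finType}.
Implicit Types (Sigma : V -> V -> R) (Z : {set V}) (u v w z : V).

(** Probabilistically, the covariance of [X v] with the linear combination of [X] with coefficients
    [t]; [bilin] below is the covariance of two such combinations. *)
Definition cov_with Sigma (t : V -> R) v : R := \sum_x t x * Sigma x v.

Lemma cov_withD Sigma s t v :
  cov_with Sigma (fun x => s x + t x) v = cov_with Sigma s v + cov_with Sigma t v.
Proof. by rewrite -big_split; apply: eq_bigr => x _; rewrite mulrDl. Qed.

Lemma cov_withZ Sigma k t v :
  cov_with Sigma (fun x => k * t x) v = k * cov_with Sigma t v.
Proof. by rewrite /cov_with mulr_sumr; apply: eq_bigr => x _; rewrite mulrA. Qed.

Definition bilin Sigma (s t : V -> R) : R := \sum_v cov_with Sigma s v * t v.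

Lemma quad_formE Sigma t : quad_form Sigma t = bilin Sigma t t.
Proof.
rewrite /quad_form /bilin exchange_big; apply: eq_bigr => v _.
by rewrite /cov_with mulr_suml.
Qed.

Lemma bilin_sym Sigma s t : posdef Sigma -> bilin Sigma s t = bilin Sigma t s.
Proof.
move=> [sym _]; rewrite /bilin /cov_with.
under eq_bigr do rewrite mulr_suml.
rewrite exchange_big; apply: eq_bigr => x _; rewrite mulr_suml.
by apply: eq_bigr => y _; rewrite (sym x y); ring.
Qed.

Lemma bilinDl Sigma r s t :
  bilin Sigma (fun x => r x + s x) t = bilin Sigma r t + bilin Sigma s t.
Proof. by rewrite -big_split; apply: eq_bigr => x _; rewrite cov_withD mulrDl. Qed.

Lemma bilinZl Sigma k s t :
  bilin Sigma (fun x => k * s x) t = k * bilin Sigma s t.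
Proof.
by rewrite /bilin mulr_sumr; apply: eq_bigr => x _; rewrite cov_withZ mulrA.
Qed.

Lemma bilinDr Sigma r s t : posdef Sigma ->
  bilin Sigma r (fun x => s x + t x) = bilin Sigma r s + bilin Sigma r t.
Proof. by move=> pd; rewrite !(bilin_sym r)// bilinDl. Qed.

Lemma bilinZr Sigma k s t : posdef Sigma ->
  bilin Sigma s (fun x => k * t x) = k * bilin Sigma s t.
Proof. by move=> pd; rewrite !(bilin_sym s)// bilinZl. Qed.

(* [sum_x r x * X x] is [X u] minus its linear regression on the [X z] with
   [z] in [Z], up to a constant. *)
Definition residual Sigma Z u (r : V -> R) : Prop :=
  [/\ r u = 1, forall w, w \notin u |: Z -> r w = 0
    & forall w, w \in Z -> cov_with Sigma r w = 0].

(** At a vertex of [Z] the factor from [s] vanishes, outside [u |: Z] the factor from [t] does, so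
    only the term at [u] survives. *)
Lemma bilin_supp Sigma Z u s t :
    u \notin Z -> (forall w, w \notin u |: Z -> t w = 0) ->
    (forall w, w \in Z -> cov_with Sigma s w = 0) ->
  bilin Sigma s t = cov_with Sigma s u * t u.
Proof.
move=> uZ t0 s0; rewrite /bilin (bigD1 u)//= big1 ?addr0// => w wu.
have [/s0->|wZ] := boolP (w \in Z); first by rewrite mul0r.
by rewrite t0 ?mulr0// !inE negb_or wu.
Qed.

(** A nonzero kernel vector, extended by zero to [V], would annihilate the positive definite
    form. *)
Lemma sub_cov_unit Sigma Z : posdef Sigma -> sub_cov Sigma Z \in unitmx.
Proof.
move=> [_ pos]; rewrite -row_free_unit -kermx_eq0.
apply/negPn/negP => /rowV0Pn[x /sub_kermxP xS x0].
(* The extension of [x] by zero outside [Z]: the sum has at most one term. *)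
pose t v := \sum_(i | enum_val i == v) x 0 i.
have tE i : t (enum_val i) = x 0 i.
  by rewrite /t (big_pred1 i)// => j; rewrite (inj_eq enum_val_inj).
have sumtE (F : V -> R) : \sum_v t v * F v = \sum_i x 0 i * F (enum_val i).
  rewrite (partition_big (@enum_val _ [in Z]) predT)//=.
  apply: eq_bigr => v _; rewrite mulr_suml.
  by apply: eq_bigr => i /eqP->.
have [i xi] : exists i, x 0 i != 0 by apply/rV0Pn.
have /pos : exists v, t v != 0 by exists (enum_val i); rewrite tE.
have -> : quad_form Sigma t = 0; last by rewrite ltxx.
rewrite quad_formE /bilin; under eq_bigr do rewrite mulrC.
rewrite (sumtE (cov_with Sigma t)) big1// => j _; rewrite /cov_with sumtE.
move/matrixP/(_ 0 j): xS; rewrite !mxE => xS.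
rewrite -[X in _ * X](_ : 0 = _) ?mulr0// -[LHS]xS.
by apply: eq_bigr => k _; rewrite mxE.
Qed.

(** The regression coefficients are the row $\Sigma_{uZ}\Sigma_{ZZ}^{-1}$, so the partial covariance
    is the plain covariance of the residual with [X v]. *)
Lemma residual_exists Sigma Z u : posdef Sigma -> u \notin Z ->
  exists2 r, residual Sigma Z u r
    & forall v, cov_with Sigma r v = partial_cov Sigma Z u v.
Proof.
move=> pd uZ; pose k := row_cov Sigma u Z *m invmx (sub_cov Sigma Z).
pose t v := \sum_(i | enum_val i == v) k 0 i.
have tN v : v \notin Z -> t v = 0.
  by move=> vZ; apply: big1 => i /eqP iv; rewrite -iv enum_valP in vZ.
have covE v : cov_with Sigma (fun x => (x == u)%:R - t x) v
              = partial_cov Sigma Z u v.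
  rewrite /cov_with /partial_cov -/k mxE.
  under eq_bigr do rewrite mulrBl.
  rewrite sumrB; congr (_ - _).
    by rewrite (bigD1 u)//= eqxx mul1r big1 ?addr0// => w /negPf->; rewrite mul0r.
  rewrite [RHS](partition_big (@enum_val _ [in Z]) predT)//=.
  apply: eq_bigr => x _; rewrite mulr_suml.
  by apply: eq_bigr => i /eqP<-; rewrite !mxE.
exists (fun x => (x == u)%:R - t x) => //; split.
- by rewrite eqxx tN// subr0.
- by move=> w; rewrite !inE negb_or => /andP[/negPf-> wZ]; rewrite tN// subr0.
- move=> w wZ; rewrite covE /partial_cov.
  (* For [w] in [Z] this is a column of [sub_cov] itself; the inverse cancels and the correction
     term becomes [Sigma u w]. *)
  have -> : col_cov Sigma Z w = col (enum_rank_in wZ w) (sub_cov Sigma Z).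
    by apply/colP => i; rewrite !mxE enum_rankK_in.
  by rewrite colE mulmxA mulmxKV ?sub_cov_unit// -colE !mxE enum_rankK_in// subrr.
Qed.

(** Residuals are unique: the difference of two of them vanishes at [u], so its variance is zero by
    [bilin_supp], and positive definiteness applies. Hence any explicit residual computes partial
    covariances. *)
Lemma residual_cov Sigma Z u r : posdef Sigma -> u \notin Z ->
  residual Sigma Z u r -> forall v, cov_with Sigma r v = partial_cov Sigma Z u v.
Proof.
move=> pd uZ [r1 r0 rZ] v; have [s [s1 s0 sZ] <-] := residual_exists pd uZ.
suff -> : r = s by [].
apply/funext => x; pose d x := r x + -1 * s x.
have [d0|[y]] : (forall y, d y = 0) \/ exists y, d y != 0.
- have [/forallP H|] := boolP [forall y, d y == 0].
    by left => y; apply/eqP.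
  by rewrite negb_forall => /existsP; right.
- by have := d0 x; rewrite /d; lra.
have [_ pos] := pd => dy; have /pos : exists y, d y != 0 by exists y.
rewrite quad_formE (@bilin_supp _ Z u)//.
- by rewrite {2}/d r1 s1 mulr1 subrr mulr0 ltxx.
- by move=> w wZ; rewrite /d r0// s0// mulr0 addr0.
- by move=> w wZ; rewrite cov_withD cov_withZ rZ// sZ// mulr0 addr0.
Qed.

(** Both sides are the covariance of the residuals of [u] and [v]. *)
Lemma partial_covC Sigma Z u v : posdef Sigma -> u \notin Z -> v \notin Z ->
  partial_cov Sigma Z u v = partial_cov Sigma Z v u.
Proof.
move=> pd uZ vZ.
have [r [r1 r0 rZ] <-] := residual_exists pd uZ.
have [s [s1 s0 sZ] <-] := residual_exists pd vZ.
have := bilin_sym r s pd.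
by rewrite (@bilin_supp _ Z v)// (@bilin_supp _ Z u)// r1 s1 !mulr1.
Qed.

Lemma partial_var_gt0 Sigma Z u : posdef Sigma -> u \notin Z ->
  0 < partial_cov Sigma Z u u.
Proof.
move=> pd uZ; have [r [r1 r0 rZ] <-] := residual_exists pd uZ.
have : 0 < quad_form Sigma r by apply: pd.2; exists u; rewrite r1 oner_eq0.
by rewrite quad_formE (@bilin_supp _ Z u)// r1 mulr1.
Qed.

(** One Gram-Schmidt step: subtracting from the residual of [u] the multiple of the residual of [z]
    that decorrelates it from [X z] gives the residual with respect to [z |: Z]. *)
Lemma partial_covU1 Sigma Z z u v : posdef Sigma ->
    z \notin Z -> u \notin z |: Z ->
  partial_cov Sigma (z |: Z) u v = partial_cov Sigma Z u v
    - partial_cov Sigma Z u z * partial_cov Sigma Z z v / partial_cov Sigma Z z z.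
Proof.
move=> pd zZ uzZ; have /norP[uz uZ] : ~~ ((u == z) || (u \in Z)).
  by move: uzZ; rewrite !inE.
have [r [r1 r0 rZ] rE] := residual_exists pd uZ.
have [s [s1 s0 sZ] sE] := residual_exists pd zZ.
pose k := - (partial_cov Sigma Z u z / partial_cov Sigma Z z z).
have z_neq0 : partial_cov Sigma Z z z != 0 by rewrite gt_eqF ?partial_var_gt0.
rewrite -(@residual_cov _ _ _ (fun x => r x + k * s x))//.
  by rewrite cov_withD cov_withZ rE sE /k mulNr mulrAC.
split.
- by rewrite r1 s0// mulr0 addr0.
- by move=> w; rewrite !inE => /norP[wu /norP[wz wZ]];
    rewrite r0 ?s0 ?mulr0 ?addr0// !inE negb_or ?wu ?wz.
- move=> w; rewrite !inE cov_withD cov_withZ.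
  have [-> _|_ /= wZ] := eqVneq w z; first by rewrite rE sE /k mulNr divfK ?subrr.
  by rewrite rZ// sZ// mulr0 addr0.
Qed.

End PartialCovariance.

(** * Paths in trees *)

Section TreePaths.
Context {V : finType} {e : rel V}.
Implicit Types (x y z : V) (p q : seq V) (Z : {set V}).

Lemma simple_path_xx x p : simple_path e x x p -> p = [::].
Proof.
case=> _; case/lastP: p => [//|p y] /= /andP[xp _].
by rewrite last_rcons => yx; rewrite yx mem_rcons mem_head in xp.
Qed.

Lemma simple_path_sym x y p : symmetric e ->
  simple_path e x y p -> simple_path e y x (rev (belast x p)).
Proof.
move=> sym_e [xp up <-]; split.
- by rewrite rev_path; under eq_path do rewrite sym_e.
- by rewrite -rev_rcons rev_uniq -lastI.
- by case: p {xp up} => //= z p; rewrite rev_cons last_rcons.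
Qed.

Lemma mem_simple_path_sym x y p : simple_path e x y p ->
  y :: rev (belast x p) =i x :: p.
Proof. by case=> _ _ <- w; rewrite -rev_rcons mem_rev -lastI. Qed.

Lemma path_meets_sym Z x y : symmetric e ->
  path_meets e Z x y -> path_meets e Z y x.
Proof.
move=> sym_e meet p yp; have [w] := meet _ (simple_path_sym sym_e yp).
by rewrite (mem_simple_path_sym yp) => ? ?; exists w.
Qed.

Lemma path_meetsS Z Z' x y : Z \subset Z' ->
  path_meets e Z x y -> path_meets e Z' x y.
Proof.
move=> /fintype.subsetP ZZ' meet p /meet[w wp wZ]; exists w => //; exact: ZZ'.
Qed.

(* Two branches leaving [x] and first meeting at [w] form a cycle. *)
Lemma acyclic_branches x w p1 p2 q1 q2 : symmetric e -> acyclic_graph e ->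
    path e x (rcons p1 w ++ p2) -> uniq (x :: rcons p1 w ++ p2) ->
    path e x (rcons q1 w ++ q2) -> uniq (x :: rcons q1 w ++ q2) ->
    ~~ has [in q1] p1 ->
  p1 = [::] /\ q1 = [::].
Proof.
move=> sym_e acyc; rewrite !cat_path => /andP[xp _] up /andP[xq _] uq p1q1.
suff /acyc : ucycle e (x :: p1 ++ w :: rev q1).
  by rewrite /= size_cat /= size_rev addnS !ltnS leqn0 addn_eq0 !size_eq0
    => /andP[/eqP-> /eqP->].
apply/andP; split.
  rewrite /= -cat_rcons rcons_cat cat_path xp last_rcons /=.
  have := rev_path e x (rcons q1 w); rewrite last_rcons belast_rcons rev_cons.
  by move->; under eq_path do rewrite sym_e.
move: up uq; rewrite !cons_uniq !mem_cat !mem_rcons !inE !cat_uniq !rcons_uniq.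
move=> /andP[/norP[/norP[xw xp1] _]] /andP[/andP[wp1 up1] _].
move=> /andP[/norP[/norP[_ xq1] _]] /andP[/andP[wq1 uq1] _].
rewrite mem_rev !negb_or xw xp1 xq1 up1 /= mem_rev rev_uniq uq1 wq1 wp1 !andbT.
apply: contra p1q1 => /hasP[z]; rewrite mem_rev => zq zp.
by apply/hasP; exists z.
Qed.

(** By induction it suffices that the first steps agree; otherwise the two paths would leave [x]
    differently and meet again, against [acyclic_branches]. *)
Lemma simple_path_uniq x y p q : symmetric e -> acyclic_graph e ->
  simple_path e x y p -> simple_path e x y q -> p = q.
Proof.
move=> sym_e acyc; elim: p x q => [|p0 p IHp] x q.
  by case=> _ _ /= -> /simple_path_xx.
case: q => [xp [_ _ /= xy]|q0 q xp xq].
  by move: xp; rewrite -xy => /simple_path_xx.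
suff p0q0 : p0 = q0.
  move: xp xq; rewrite -p0q0 => -[/= /andP[_ xp] /andP[_ up] lp].
  by move=> -[/= /andP[_ xq] /andP[_ uq] lq]; rewrite (IHp p0 q).
case: xp xq => xp up lp [xq uq lq].
have hasP : has [in q0 :: q] (p0 :: p).
  by apply/hasP; exists y; [rewrite -lp /= mem_last | rewrite -lq /= mem_last].
have [P PE] : exists P, p0 :: p = P by exists (p0 :: p).
have [Q QE] : exists Q, q0 :: q = Q by exists (q0 :: q).
rewrite PE QE in xp up xq uq hasP; move: PE xp up xq uq => {lp lq}.
(* [w] is the first vertex of one path lying on the other, so the segment [p1] before it avoids the
   other path. *)
case/split_find: hasP => w p1 p2 wQ p1Q PE xp up xq uq.
move: QE p1Q xq uq; case/path.splitP: wQ => q1 q2 QE p1Q xq uq.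
have [|p10 q10] := acyclic_branches sym_e acyc xp up xq uq.
  apply: contra p1Q => /hasP[z zp1 zq1]; apply/hasP; exists z => //=.
  by rewrite mem_cat mem_rcons inE zq1 orbT.
by move: PE QE; rewrite p10 q10 => -[-> _] [-> _].
Qed.

(** Following [s] to [b] and then [p] to [c] gives a simple path, which is the only one from [z] to
    [c]. *)
Lemma branch_meets a c z b p s : symmetric e -> acyclic_graph e ->
    simple_path e a c p -> b \in a :: p -> simple_path e z b s ->
    (forall w, w \in z :: s -> w \in a :: p -> w = b) ->
  path_meets e [set b] z c.
Proof.
move=> sym_e acyc [ap up lp] bp [zs us ls] sP q zq.
have [p2 [bp2 ubp2 lp2 p2P]] : exists p2,
    [/\ path e b p2, uniq (b :: p2), last b p2 = c & {subset p2 <= a :: p}].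
  case/splitPl: bp ap up lp sP => p1 p2 lp1 ap up lp _.
  exists p2; split.
  - by move: ap; rewrite cat_path lp1 => /andP[].
  - move: up; rewrite -cat_cons lastI lp1 cat_rcons cat_uniq.
    by case/and3P.
  - by rewrite -lp last_cat lp1.
  - by move=> w; rewrite inE mem_cat => ->; rewrite !orbT.
suff -> : q = s ++ p2.
  exists b; last by rewrite inE.
  by rewrite -cat_cons mem_cat -ls mem_last.
apply: (simple_path_uniq sym_e acyc zq); split.
- by rewrite cat_path zs ls.
- rewrite -cat_cons cat_uniq us /=; move: ubp2 => /= /andP[bp2' ->].
  rewrite andbT; apply/hasPn => w wp2; apply/negP => ws.
  by move: bp2'; rewrite -(sP w ws (p2P _ wp2)) wp2.
- by rewrite last_cat ls.
Qed.

(** Walk along [q] and stop at the first vertex of [a :: p]; the end [a] guarantees that there is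
    one. *)
Lemma first_hit a p z q : simple_path e z a q ->
  exists b s, [/\ b \in a :: p, simple_path e z b s, {subset s <= q}
    & forall w, w \in z :: s -> w \in a :: p -> w = b].
Proof.
elim: q z => [|z' q IHq] z [zq uq lq].
  by exists z, [::]; split=> //; [rewrite -lq mem_head | move=> w; rewrite !inE => /eqP->].
have [zp|zp] := boolP (z \in a :: p).
  by exists z, [::]; split=> //; move=> w; rewrite !inE => /eqP->.
move: zq uq lq => /= /andP[zz' zq] /andP[zNq uq] lq.
have [b [s [bp [zs us ls] sq sP]]] := IHq z' (And3 zq uq lq).
have sq' : {subset z' :: s <= z' :: q}.
  by move=> w; rewrite !inE => /orP[->//|/sq->]; rewrite orbT.
exists b, (z' :: s); split=> //.
- split=> //; first by rewrite /= zz'.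
  by rewrite cons_uniq us andbT; apply: contra zNq => /sq'.
- move=> w; rewrite inE => /orP[/eqP-> /(negP zp)//|]; exact: sP.
Qed.

(** [b] is the point where the path from [z] to [a] first hits the path [p]. Separation from [c] is
    [branch_meets], and separation from [a] is the same for the reversed path. *)
Lemma tree_gate a c z p : is_tree e -> simple_path e a c p ->
  exists2 b, b \in a :: p & [/\ path_meets e [set b] a c,
    path_meets e [set b] a z & path_meets e [set b] c z].
Proof.
move=> [sym_e _ conn acyc] ap.
have /connectP[q0 zq0 lq0] := conn z a.
case/shortenP: zq0 lq0 => q zq uq _ lq.
have [b [s [bp zs _ sP]]] := first_hit p (And3 zq uq (esym lq)).
exists b => //; split.
- move=> p'; move/(simple_path_uniq sym_e acyc ap) => <-.
  by exists b => //; rewrite inE.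
- apply: path_meets_sym => //.
  have cp := simple_path_sym sym_e ap; have memE := mem_simple_path_sym ap.
  apply: (branch_meets sym_e acyc cp _ zs); first by rewrite memE.
  by move=> w ws; rewrite memE; exact: sP.
- by apply: path_meets_sym => //; exact: branch_meets sym_e acyc ap bp zs sP.
Qed.

End TreePaths.

(** * Monotonicity of partial correlations on a tree *)

Section TreeCorrelations.
Context {R : realType} {V : finType} {e : rel V} {Sigma : V -> V -> R}.
Hypothesis tree_e : is_tree e.
Hypothesis pd : posdef Sigma.
Hypothesis markov : forall u v (Z : {set V}), u != v -> u \notin Z ->
  v \notin Z -> path_meets e Z u v -> partial_cov Sigma Z u v = 0.
Implicit Types (Z : {set V}) (a c u v w z b : V).
Local Notation pcov := (partial_cov Sigma).

Lemma sq_partial_corr_ge0 Z u v : u \notin Z -> v \notin Z ->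
  0 <= sq_partial_corr Sigma u v Z.
Proof.
move=> uZ vZ; rewrite divr_ge0 ?sqr_ge0// mulr_ge0// ltW//.
- exact: partial_var_gt0.
- exact: partial_var_gt0.
Qed.

(** By [partial_covU1], the difference of the two sides is the variance at [v] times the positive
    partial variance of [u] given [v |: Z]. *)
Lemma partial_cov_CS Z u v : u \notin Z -> v \notin Z ->
  pcov Z u v ^+ 2 <= pcov Z u u * pcov Z v v.
Proof.
move=> uZ vZ; have [->|uv] := eqVneq u v; first by rewrite expr2.
have uvZ : u \notin v |: Z by rewrite !inE negb_or uv.
have := partial_var_gt0 pd uvZ; rewrite partial_covU1//.
rewrite subr_gt0 ltr_pdivrMr ?partial_var_gt0// (partial_covC pd vZ uZ) -expr2.
exact: ltW.
Qed.

(** The partial covariance given [b |: Z] vanishes by separation; expand it with [partial_covU1]. *)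
Lemma partial_cov_through Z b u v : u != v -> u \notin Z -> v \notin Z ->
  b \notin Z -> path_meets e [set b] u v ->
  pcov Z u v * pcov Z b b = pcov Z u b * pcov Z v b.
Proof.
move=> uv uZ vZ bZ bP.
have [->|ub] := eqVneq u b; first by rewrite mulrC (partial_covC pd bZ vZ).
have [->|vb] := eqVneq v b; first by [].
have : pcov (b |: Z) u v = 0.
  apply: markov => //; rewrite ?inE ?negb_or ?ub ?vb//.
  by apply: path_meetsS bP; rewrite finset.sub1set setU11.
rewrite partial_covU1 ?inE ?negb_or ?ub// (partial_covC pd bZ vZ).
move/eqP; rewrite subr_eq0 => /eqP->.
by rewrite divfK// gt_eqF// partial_var_gt0.
Qed.

(* In terms of the correlations [x], [y], [w] of [a], [c], [z] with [b], this
   says [(x y (1 - w^2))^2 <= (x y)^2 (1 - x^2 w^2) (1 - y^2 w^2)]. *)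
Lemma sq_partial_corr_le_gate Z a c z b : a != c -> a \notin z |: Z ->
    c \notin z |: Z -> z \notin Z -> b \notin Z ->
    path_meets e [set b] a c -> path_meets e [set b] a z ->
    path_meets e [set b] c z ->
  sq_partial_corr Sigma a c (z |: Z) <= sq_partial_corr Sigma a c Z.
Proof.
move=> ac azZ czZ zZ bZ bac baz bcz.
have /norP[az aZ] : ~~ ((a == z) || (a \in Z)) by move: azZ; rewrite !inE.
have /norP[cz cZ] : ~~ ((c == z) || (c \in Z)) by move: czZ; rewrite !inE.
have Eac := partial_cov_through ac aZ cZ bZ bac.
have Eaz := partial_cov_through az aZ zZ bZ baz.
have Ecz := partial_cov_through cz cZ zZ bZ bcz.
have := partial_var_gt0 pd azZ; have := partial_var_gt0 pd czZ.
have := partial_var_gt0 pd aZ; have := partial_var_gt0 pd cZ.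
have := partial_cov_CS aZ bZ; have := partial_cov_CS cZ bZ.
have := partial_cov_CS zZ bZ.
have := partial_var_gt0 pd zZ; have := partial_var_gt0 pd bZ.
rewrite /sq_partial_corr !partial_covU1// (partial_covC pd zZ cZ).
rewrite (partial_covC pd zZ aZ).
move: Eac Eaz Ecz.
move: (pcov Z a c) (pcov Z a z) (pcov Z c z) => AC AZ CZ.
move: (pcov Z a a) (pcov Z b b) (pcov Z c c) (pcov Z z z) => A B C Y.
move: (pcov Z a b) (pcov Z c b) (pcov Z z b) => x y w Eac Eaz Ecz.
move=> B0 Y0 wYB yCB xAB C0 A0 C1 A1.
have {Eac} -> : AC = x * y / B by rewrite -Eac mulfK ?gt_eqF.
have {}Eaz : AZ = x * w / B by rewrite -Eaz mulfK ?gt_eqF.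
have {}Ecz : CZ = y * w / B by rewrite -Ecz mulfK ?gt_eqF.
(* Here [x], [y], [w] are partial covariances with [b]. [W] is the squared partial correlation of
   [z] and [b], while [X] and [Q] are the parts of the variances [A] and [C] explained by [b]. *)
pose W := w ^+ 2 / (B * Y); pose X := x ^+ 2 / B; pose Q := y ^+ 2 / B.
have W0 : 0 <= W by rewrite divr_ge0 ?sqr_ge0// mulr_ge0 ?ltW.
have W1 : W <= 1 by rewrite ler_pdivrMr ?mul1r ?mulr_gt0// mulrC.
have XA : X <= A by rewrite ler_pdivrMr.
have QC : Q <= C by rewrite ler_pdivrMr.
have EA : A - AZ * AZ / Y = A - X * W.
  by rewrite Eaz /X /W; field; rewrite !gt_eqF.
have EC : C - CZ * CZ / Y = C - Q * W.
  by rewrite Ecz /Q /W; field; rewrite !gt_eqF.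
have EN : x * y / B - AZ * CZ / Y = x * y / B * (1 - W).
  by rewrite Eaz Ecz /W; field; rewrite !gt_eqF.
rewrite EN EA EC in A1 C1 *; set N := x * y / B.
(* After removing the factor [N ^+ 2], the claim is $(1-W)^2AC\le(A-XW)(C-QW)$, which holds factor
   by factor as $X\le A$ and $Q\le C$. *)
rewrite exprMn -[leLHS]mulrA ler_wpM2l ?sqr_ge0//.
rewrite ler_pdivrMr ?mulr_gt0// mulrC ler_pdivlMr ?mulr_gt0//.
have -> : (1 - W) ^+ 2 * (A * C) = (A * (1 - W)) * (C * (1 - W)) by ring.
by apply: ler_pM; nra.
Qed.

(** If [z |: Z] separates [a] from [c], the left side is zero. Otherwise some path avoids [z |: Z],
    and the gate of [z] on that path is a vertex outside [Z]. *)
Lemma sq_partial_corr_leU1 Z a c z : a != c -> a \notin z |: Z ->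
    c \notin z |: Z ->
  sq_partial_corr Sigma a c (z |: Z) <= sq_partial_corr Sigma a c Z.
Proof.
move=> ac azZ czZ.
have [zZ|zZ] := boolP (z \in Z); first by rewrite (finset.setUidPr _) ?finset.sub1set.
have aZ : a \notin Z by apply: contra azZ; rewrite inE orbC => ->.
have cZ : c \notin Z by apply: contra czZ; rewrite inE orbC => ->.
have [meet|] := pselect (path_meets e (z |: Z) a c).
  by rewrite {1}/sq_partial_corr markov// expr0n mul0r sq_partial_corr_ge0.
move=> /existsNP[p /not_implyP[ap pN]].
have [b bp [bac baz bcz]] := tree_gate z tree_e ap.
apply: (sq_partial_corr_le_gate (b := b)) => //.
by apply/negP => bZ; apply: pN; exists b; rewrite // inE bZ orbT.
Qed.

Lemma sq_partial_corr_leU Z W a c : a != c -> a \notin Z :|: W ->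
    c \notin Z :|: W ->
  sq_partial_corr Sigma a c (Z :|: W) <= sq_partial_corr Sigma a c Z.
Proof.
move=> ac; rewrite -(finset.set_enum W).
elim: (enum W) => [|w s IHs]; first by rewrite finset.set_nil finset.setU0.
rewrite finset.set_cons finset.setUCA => aw cw.
have aN : a \notin Z :|: [set x in s] by apply: contra aw => xS; rewrite inE xS orbT.
have cN : c \notin Z :|: [set x in s] by apply: contra cw => xS; rewrite inE xS orbT.
by apply: le_trans (IHs aN cN); exact: sq_partial_corr_leU1.
Qed.

(** Each vertex [w] adjoined has zero partial covariance with [a] and with [c], so the correction
    terms of [partial_covU1] are zero. *)
Lemma sq_partial_corr_sepU Z W a c : a \notin Z :|: W -> c \notin Z :|: W ->
    (forall w, w \in W -> path_meets e Z a w /\ path_meets e Z c w) ->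
  sq_partial_corr Sigma a c (Z :|: W) = sq_partial_corr Sigma a c Z.
Proof.
rewrite -(finset.set_enum W).
elim: (enum W) => [|w s IHs]; first by rewrite finset.set_nil finset.setU0.
rewrite finset.set_cons finset.setUCA => aw cw meet.
set S := Z :|: [set x in s] in aw cw *.
have aN : a \notin S by apply: contra aw => xS; rewrite inE xS orbT.
have cN : c \notin S by apply: contra cw => xS; rewrite inE xS orbT.
rewrite -IHs//; last by move=> x xs; apply: meet; rewrite inE xs orbT.
have [wS|wS] := boolP (w \in S); first by rewrite (finset.setUidPr _) ?finset.sub1set.
have [meet_a meet_c] : path_meets e Z a w /\ path_meets e Z c w.
  by apply: meet; rewrite setU11.
have aw0 : pcov S a w = 0.
  apply: markov => //; last by apply: path_meetsS meet_a; exact: finset.subsetUl.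
  by apply: contraNneq aw => ->; rewrite setU11.
have cw0 : pcov S c w = 0.
  apply: markov => //; last by apply: path_meetsS meet_c; exact: finset.subsetUl.
  by apply: contraNneq cw => ->; rewrite setU11.
by rewrite /sq_partial_corr !partial_covU1// aw0 cw0 !mul0r !subr0.
Qed.

(** Pass through the union: adjoining [Z2] to [Z1] changes nothing, and adjoining [Z1] to [Z2] can
    only decrease the value. *)
Lemma sq_partial_corr_sep_le Z1 Z2 a c : a != c ->
    a \notin Z1 -> c \notin Z1 -> a \notin Z2 -> c \notin Z2 ->
    (forall z, z \in Z2 -> path_meets e Z1 a z /\ path_meets e Z1 c z) ->
  sq_partial_corr Sigma a c Z1 <= sq_partial_corr Sigma a c Z2.
Proof.
move=> ac aZ1 cZ1 aZ2 cZ2 meet.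
rewrite -(sq_partial_corr_sepU _ _ meet) ?inE ?negb_or ?aZ1 ?cZ1//.
by rewrite finset.setUC sq_partial_corr_leU// ?inE ?negb_or ?aZ1 ?cZ1 ?aZ2 ?cZ2.
Qed.

End TreeCorrelations.

(** * Normal laws *)

Section NormalLaw.
Context {R : realType}.
Local Notation mu := (@lebesgue_measure R).
Local Open Scope classical_set_scope.

(** The Radon-Nikodym derivative of the normal law agrees almost everywhere with the explicit
    density, since both have the same integral over every measurable set. *)
Lemma ge0_integral_normal_prob (m s : R) (f : R -> \bar R) :
    (forall x, 0 <= f x)%E -> measurable_fun setT f ->
  (\int[normal_prob m s]_x f x = \int[mu]_x (f x * (normal_pdf m s x)%:E))%E.
Proof.
move=> f0 mf; have dom := normal_prob_dominates m s.
rewrite -(Radon_Nikodym_SigmaFinite.change_of_variables dom)//.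
have mg : measurable_fun setT (Radon_Nikodym_SigmaFinite.f (normal_prob m s) mu).
  exact: measurable_int (Radon_Nikodym_SigmaFinite.f_integrable dom).
have mp : measurable_fun setT (EFin \o normal_pdf m s).
  by apply/measurable_EFinP; exact: measurable_normal_pdf.
apply: ae_eq_integral => //; [exact: emeasurable_funM|exact: emeasurable_funM|].
apply: ae_eqe_mul2l; apply: integral_ae_eq => //.
- exact: Radon_Nikodym_SigmaFinite.f_integrable.
- by move=> E _ mE; rewrite -Radon_Nikodym_SigmaFinite.f_integral.
Qed.

Lemma normal_prob_affine (m s : R) (f : R -> R) : 0 < s ->
    (forall x, 0 <= f x) -> continuous f ->
  (\int[normal_prob m s]_x (f x)%:E
   = \int[normal_prob 0 1]_x (f (s * x + m))%:E)%E.
Proof.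
move=> s0 f0 cf.
(* Factored as a shift followed by a scaling, so that its limits at both infinities follow from
   those of the shift. *)
pose F (x : R^o) : R^o := (x + m / s) * s.
have FE x : F x = s * x + m by rewrite /F mulrDl divfK ?gt_eqF// mulrC.
have dF (x : R^o) : is_derive x 1 F s.
  by apply: is_derive_eq; rewrite scaler0 add0r addr0 scaler1.
have F'E : F^`() = cst s.
  by apply/funext => x; rewrite derive1E; exact: (@derive_val _ _ _ _ _ _ _ (dF x)).
have cF : continuous F.
  by move=> x; apply: cvgM; [apply: cvgD; [exact: cvg_id|exact: cvg_cst]|exact: cvg_cst].
have mf : measurable_fun setT f by exact: continuous_measurable_fun.
have mfF : measurable_fun setT (f \o F).
  by apply: continuous_measurable_fun => x; apply: continuous_comp; [exact: cF|exact: cf].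
rewrite (@ge0_integral_normal_prob m s (EFin \o f)); last 2 first.
- by move=> x; rewrite /= lee_fin.
- exact/measurable_EFinP.
under [RHS]eq_integral do rewrite -FE.
rewrite (@ge0_integral_normal_prob 0 1 (EFin \o (f \o F))); last 2 first.
- by move=> x; rewrite /= lee_fin.
- exact/measurable_EFinP.
under eq_integral do rewrite -EFinM.
rewrite (@increasing_ge0_integration_by_substitutionT _ F
   (fun x => f x * normal_pdf m s x)).
- apply: eq_integral => x _; rewrite -EFinM; congr EFin.
  (* The derivative [s] of the substitution cancels the factor [1 / s] in the peak of the
     density. *)
  rewrite F'E /= !fctE /= -mulrA; congr (_ * _).
  rewrite !normal_pdfE ?gt_eqF// /normal_peak /normal_fun FE addrK subr0.
  have -> : - (s * x) ^+ 2 / (s ^+ 2 *+ 2) = - x ^+ 2 / (1 ^+ 2 *+ 2).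
    by field; rewrite gt_eqF.
  rewrite -!mulrnAr expr1n mul1r sqrtrM ?sqr_ge0// sqrtr_sqr gtr0_norm//.
  by rewrite mul1r invfM [LHS]mulrC !mulrA mulfV ?gt_eqF// mul1r.
- by move=> x y xy; rewrite /F ltr_pM2r// ltrD2r.
- by rewrite F'E => ?; exact: cvg_cst.
- by rewrite F'E; exact: is_cvg_cst.
- by rewrite F'E; exact: is_cvg_cst.
- by move=> x; exact: ex_derive.
- by apply/gt0_cvgMlNy; last exact: cvg_addrr_Ny.
- by apply/gt0_cvgMly; last exact: cvg_addrr.
- by move=> x; apply: cvgM; [exact: cf|apply: continuous_normal_pdf; rewrite gt_eqF].
- by move=> x; rewrite mulr_ge0 ?normal_pdf_ge0.
Qed.

(* [x^2 <= 4 e^{x^2/4}], so [x^2] times the density is dominated by another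
   normal density. *)
Lemma normal_second_moment_fin :
  (\int[normal_prob 0 1]_x (x ^+ 2 : R)%:E < +oo)%E.
Proof.
have mX2 : measurable_fun setT (fun x : R => x ^+ 2) by exact: measurable_funX.
rewrite (@ge0_integral_normal_prob 0 1 (fun x => (x ^+ 2)%:E)); last 2 first.
- by move=> x; rewrite /= lee_fin sqr_ge0.
- exact/measurable_EFinP.
(* The density with standard deviation $\sqrt2$ is proportional to $e^{-x^2/4}$; [k] combines the
   constant 4 with the ratio of the two peaks. *)
pose s : R := Num.sqrt 2.
have s0 : s != 0 by rewrite gt_eqF// sqrtr_gt0.
pose k := 4 * normal_peak 1 / normal_peak s : R.
have k0 : 0 <= k by rewrite divr_ge0 ?mulr_ge0 ?normal_peak_ge0.
apply: (@le_lt_trans _ _ (\int[mu]_x (k * normal_pdf 0 s x)%:E)%E).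
  apply: ge0_le_integral => //.
  - by move=> x _; rewrite -EFinM lee_fin mulr_ge0 ?sqr_ge0 ?normal_pdf_ge0.
  - apply: emeasurable_funM; apply/measurable_EFinP => //.
    exact: measurable_normal_pdf.
  - apply/measurable_EFinP; apply: measurable_funM => //.
    exact: measurable_normal_pdf.
  - move=> x _; rewrite -EFinM lee_fin !normal_pdfE ?oner_eq0// /normal_fun.
    have -> : k * (normal_peak s * expR (- (x - 0) ^+ 2 / (s ^+ 2 *+ 2)))
        = normal_peak 1 * (4 * expR (- (x - 0) ^+ 2 / (s ^+ 2 *+ 2))).
      by rewrite /k; field; rewrite gt_eqF// normal_peak_gt0.
    rewrite mulrCA ler_wpM2l ?normal_peak_ge0// sqr_sqrtr// subr0.
    have -> : - x ^+ 2 / (1 ^+ 2 *+ 2) = - x ^+ 2 / (2 *+ 2) + - (x ^+ 2 / 4).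
      by field.
    rewrite expRD mulrCA [leRHS]mulrC ler_wpM2l ?expR_ge0//.
    rewrite expRN ler_pdivrMr ?expR_gt0// mulrC -ler_pdivrMr// mulrC.
    have := expR_ge1Dx (x ^+ 2 / 4); rewrite mulrC; lra.
under eq_integral do rewrite EFinM.
rewrite integralZl//; last exact: integrable_normal_pdf.
by rewrite integral_normal_pdf mule1 ltry.
Qed.

(** Otherwise [x ^+ 2] would vanish almost everywhere, so all mass would sit at [0], a null set for
    a law dominated by Lebesgue measure. *)
Lemma normal_second_moment_gt0 :
  (0 < \int[normal_prob 0 1]_x (x ^+ 2 : R)%:E)%E.
Proof.
have mX2 : measurable_fun setT (fun x : R => x ^+ 2) by exact: measurable_funX.
rewrite lt_neqAle integral_ge0 ?andbT; last by move=> x _; rewrite lee_fin sqr_ge0.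
apply/eqP => /esym I0.
have /ae_eq_integral_abs : (\int[normal_prob 0 1]_x `|(x ^+ 2 : R)%:E| = 0)%E.
  rewrite -[RHS]I0; apply: eq_integral => x _.
  by rewrite gee0_abs// lee_fin sqr_ge0.
case=> //; first exact/measurable_EFinP.
move=> A [mA A0 subA].
have N0 : normal_prob 0 1 [set (0 : R)] = 0%E.
  have /null_content_dominatesP := normal_prob_dominates (0 : R) 1.
  by apply => //; exact: lebesgue_measure_set1.
have : (normal_prob 0%R 1%R [set: R]
    <= normal_prob 0%R 1%R A + normal_prob 0%R 1%R [set 0%R : R])%E.
  apply: (@le_trans _ _ (normal_prob 0 1 (A `|` [set (0 : R)]))); last first.
    exact: measureU2.
  apply: le_measure; rewrite ?inE//; first exact: measurableU.
  move=> x _; have [->|x0] := eqVneq x 0; first by right.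
  left; apply: subA => /= /(_ I) [] /eqP.
  by rewrite expf_eq0/= (negPf x0).
by rewrite probability_setT A0 N0 adde0 leNgt lte01.
Qed.

End NormalLaw.

(** * Expectations *)

Section Expectation.
Context {d : measure_display} {Omega : measurableType d} {R : realType}.
Variable P : probability Omega R.
Local Open Scope classical_set_scope.
Implicit Types (f g k : Omega -> R) (A : set Omega).

Definition L1 f := P.-integrable setT (EFin \o f).
Definition Ex f : R := \int[P]_w f w.

Definition bounded_mfun k :=
  measurable_fun setT k /\ exists M, forall w, `|k w| <= M.

Lemma L1_measurable f : L1 f -> measurable_fun setT f.
Proof. by move=> /(measurable_int P)/measurable_EFinP. Qed.

Lemma L1_le f g : measurable_fun setT f -> L1 g ->
  (forall w, `|f w| <= `|g w|) -> L1 f.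
Proof.
move=> mf g1 fg; apply: le_integrable g1 => //; first exact/measurable_EFinP.
by move=> w _; rewrite lee_fin.
Qed.

Lemma L1D f g : L1 f -> L1 g -> L1 (fun w => f w + g w).
Proof. by move=> f1 g1; exact: (integrableD measurableT f1 g1). Qed.

Lemma L1Z f r : L1 f -> L1 (fun w => r * f w).
Proof. by move=> f1; exact: (integrableZl measurableT r f1). Qed.

Lemma L1B f g : L1 f -> L1 g -> L1 (fun w => f w - g w).
Proof. by move=> f1 g1; exact: (integrableB measurableT f1 g1). Qed.

Lemma L1M f k : L1 f -> bounded_mfun k -> L1 (fun w => f w * k w).
Proof.
move=> f1 [mk [M kM]]; apply: (@L1_le _ (fun w => M * f w)).
- by apply: measurable_funM => //; exact: L1_measurable.
- exact: L1Z.
- move=> w; rewrite !normrM mulrC ler_wpM2r//.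
  exact: le_trans (kM w) (ler_norm _).
Qed.

Lemma bounded_L1 k : bounded_mfun k -> L1 k.
Proof.
move=> [mk [M kM]]; apply: (@L1_le _ (cst M)) => //.
  exact: finite_measure_integrable_cst.
by move=> w; exact: le_trans (kM w) (ler_norm _).
Qed.

Lemma bounded_mfun_cst r : bounded_mfun (fun=> r).
Proof. by split=> //; exists `|r|. Qed.

Lemma bounded_mfunD f g : bounded_mfun f -> bounded_mfun g ->
  bounded_mfun (fun w => f w + g w).
Proof.
move=> [mf [M fM]] [mg [N gN]]; split; first exact: measurable_funD.
by exists (M + N) => w; rewrite (le_trans (ler_normD _ _))// lerD.
Qed.

Lemma bounded_mfunM f g : bounded_mfun f -> bounded_mfun g ->
  bounded_mfun (fun w => f w * g w).
Proof.
move=> [mf [M fM]] [mg [N gN]]; split; first exact: measurable_funM.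
by exists (M * N) => w; rewrite normrM ler_pM.
Qed.

Lemma bounded_mfun_indic A : measurable A -> bounded_mfun \1_A.
Proof.
move=> mA; split; first exact: measurable_indic.
by exists 1 => w; rewrite indicE; case: (w \in A); rewrite ?normr1 ?normr0.
Qed.

Lemma bounded_mfun_comp f (k : R -> R) : measurable_fun setT f ->
  continuous k -> (exists M, forall x, `|k x| <= M) -> bounded_mfun (k \o f).
Proof.
move=> mf ck [M kM]; split; last by exists M => w; exact: kM.
by apply: measurableT_comp => //; exact: continuous_measurable_fun.
Qed.

Lemma bounded_mfun_cos f : measurable_fun setT f -> bounded_mfun (cos \o f).
Proof.
move=> mf; apply: bounded_mfun_comp => //; first exact: continuous_cos.
by exists 1; exact: cos_max.
Qed.

Lemma bounded_mfun_sin f : measurable_fun setT f -> bounded_mfun (sin \o f).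
Proof.
move=> mf; apply: bounded_mfun_comp => //; first exact: continuous_sin.
by exists 1; exact: sin_max.
Qed.

Lemma ExD f g : L1 f -> L1 g -> Ex (fun w => f w + g w) = Ex f + Ex g.
Proof. by move=> ? ?; exact: RintegralD. Qed.

Lemma ExB f g : L1 f -> L1 g -> Ex (fun w => f w - g w) = Ex f - Ex g.
Proof. by move=> ? ?; exact: RintegralB. Qed.

Lemma ExZ f r : L1 f -> Ex (fun w => r * f w) = r * Ex f.
Proof. by move=> ?; exact: RintegralZl. Qed.

Lemma eq_Ex f g : (forall w, f w = g w) -> Ex f = Ex g.
Proof. by move=> fg; apply: eq_Rintegral => w _. Qed.

Lemma Ex_cvg (f_ : nat -> Omega -> R) f g :
    (forall n, measurable_fun setT (f_ n)) ->
    (forall w, f_ ^~ w @ \oo --> f w) -> L1 g ->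
    (forall n w, `|f_ n w| <= g w) ->
  L1 f /\ Ex (f_ n) @[n --> \oo] --> Ex f.
Proof.
move=> mf cf g1 fg.
have mf' : measurable_fun setT f.
  by apply: (@measurable_fun_cvg _ _ _ setT f_) => // w _.
have [|||||f1 _ If] := @dominated_convergence _ _ _ P setT measurableT
    (fun n => EFin \o f_ n) (EFin \o f) (EFin \o g).
- by move=> n; exact/measurable_EFinP.
- exact/measurable_EFinP.
- by apply: aeW => w _; apply: cvg_EFin; [exact: nearW|exact: cf].
- exact: g1.
- by apply: aeW => w n _; rewrite lee_fin.
split=> //; apply: fine_cvg.
by rewrite fineK; [exact: If|exact: integrable_fin_num].
Qed.

Lemma Ex_cvg0 (f_ : nat -> Omega -> R) f g :
    (forall n, measurable_fun setT (f_ n)) ->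
    (forall w, f_ ^~ w @ \oo --> f w) -> L1 g ->
    (forall n w, `|f_ n w| <= g w) -> (forall n, Ex (f_ n) = 0) ->
  L1 f /\ Ex f = 0.
Proof.
move=> mf cf g1 fg f0; have [f1 If] := Ex_cvg mf cf g1 fg; split=> //.
apply/esym; move: If; under eq_fun do rewrite f0.
by move=> /cvg_lim <- //; rewrite lim_cst.
Qed.

End Expectation.

(** * Two pointwise limits *)

Section StepApproximation.
Context {R : realType}.
Local Open Scope classical_set_scope.
Implicit Types x y t : R.

Lemma bernoulli_le x n : 0 <= x <= 1 -> 1 - n%:R * x <= (1 - x) ^+ n.
Proof.
move=> /andP[x0 x1]; elim: n => [|n IHn]; first by rewrite mul0r subr0 expr0.
rewrite exprS; have n0 : 0 <= n%:R :> R by [].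
apply: (@le_trans _ _ ((1 - x) * (1 - n%:R * x))).
  by rewrite -natr1; nra.
by rewrite ler_wpM2l// subr_ge0.
Qed.

(** Bernoulli's inequality bounds the left side by $(1-x)^n(1+x)^n=(1-x^2)^n$. *)
Lemma bernoulli_ge x n : 0 <= x <= 1 -> (1 - x) ^+ n * (1 + n%:R * x) <= 1.
Proof.
move=> /andP[x0 x1]; apply: (@le_trans _ _ ((1 - x) ^+ n * (1 + x) ^+ n)).
  rewrite ler_wpM2l ?exprn_ge0 ?subr_ge0//.
  elim: n => [|n IHn]; first by rewrite mul0r addr0 expr0.
  rewrite exprS; apply: (@le_trans _ _ ((1 + x) * (1 + n%:R * x))).
    have n0 : 0 <= n%:R :> R by [].
    by rewrite -natr1; nra.
  by rewrite ler_wpM2l// addr_ge0.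
by rewrite -exprMn exprn_ile1//; nra.
Qed.

(** With $y=\sqrt x$, comparison with a geometric sum gives $ny^n(1-y)\le1$, so $nx^n\le
    y^n/(1-y)$. *)
Lemma natr_mul_expr_cvg0 x : 0 <= x < 1 -> n%:R * x ^+ n @[n --> \oo] --> 0.
Proof.
move=> /andP[x0 x1]; pose y := Num.sqrt x.
have y0 : 0 <= y by exact: sqrtr_ge0.
have y1 : y < 1 by rewrite -sqrtr1 ltr_sqrt.
have ny n : n%:R * y ^+ n * (1 - y) <= 1 - y ^+ n.
  elim: n => [|n IHn]; first by rewrite !mul0r expr0 subrr.
  have yn1 : y ^+ n <= 1 by rewrite exprn_ile1// ltW.
  have yn0 : 0 <= y ^+ n by rewrite exprn_ge0.
  rewrite exprS -natr1; set a := y ^+ n in IHn yn1 yn0 *.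
  have : y * (n%:R * a * (1 - y)) <= y * (1 - a) by rewrite ler_wpM2l.
  have : 0 <= (1 - y) * (1 - y * a) by rewrite mulr_ge0//; nra.
  nra.
apply: (@squeeze_cvgr _ _ _ _ (cst 0) (fun n => (1 - y)^-1 * y ^+ n)).
- apply: nearW => n; rewrite mulr_ge0 ?exprn_ge0//=.
  have -> : x ^+ n = y ^+ n * y ^+ n by rewrite -exprMn -expr2 sqr_sqrtr.
  have yn0 : 0 <= y ^+ n by rewrite exprn_ge0.
  rewrite ler_pdivlMl ?subr_gt0//; have := ny n.
  set a := y ^+ n in yn0 * => nyn.
  have : a * (n%:R * a * (1 - y)) <= a * (1 - a) by rewrite ler_wpM2l.
  by nra.
- exact: cvg_cst.
- rewrite -(mulr0 (1 - y)^-1); apply: cvgM; first exact: cvg_cst.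
  by apply: cvg_expr; rewrite ger0_norm.
Qed.

(** Polynomials approximating the indicator of $t<1/2$ on $[0,1]$, as in elementary proofs of the
    Stone-Weierstrass theorem. Being polynomials, they preserve an algebra of functions. *)
Definition step_poly (n : nat) t : R := (1 - t ^+ n) ^+ (n * 2 ^ n).

Lemma step_poly_ge0_le1 n t : 0 <= t <= 1 -> 0 <= step_poly n t <= 1.
Proof.
move=> /andP[t0 t1]; have tn0 : 0 <= t ^+ n by rewrite exprn_ge0.
have tn1 : t ^+ n <= 1 by rewrite exprn_ile1.
by rewrite exprn_ge0 ?exprn_ile1 ?subr_ge0// gerBl.
Qed.

(* The exponent [n * 2 ^ n] makes [n * 2 ^ n * t ^+ n] tend to [0] for
   [t < 1/2] and to infinity for [t >= 1/2]. *)
Lemma step_poly_cvg t : 0 <= t <= 1 ->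
  (step_poly n t) @[n --> \oo] --> ((t < 2^-1)%R%:R : R).
Proof.
move=> t01; have /andP[t0 t1] := t01.
have tn n : 0 <= t ^+ n <= 1 by rewrite exprn_ge0 ?exprn_ile1.
have mE n : (n * 2 ^ n)%:R * t ^+ n = n%:R * (2 * t) ^+ n :> R.
  by rewrite natrM natrX exprMn mulrA.
have [t2|t2] := ltP t 2^-1.
- apply: (@squeeze_cvgr _ _ _ _ (fun n => 1 - n%:R * (2 * t) ^+ n) (cst 1)).
  + apply: nearW => n; rewrite -mE bernoulli_le//=.
    by have /andP[] := step_poly_ge0_le1 n t01.
  + rewrite -[X in _ --> X]subr0; apply: cvgB; first exact: cvg_cst.
    by apply: natr_mul_expr_cvg0; apply/andP; split; lra.
  + exact: cvg_cst.
- apply: (@squeeze_cvgr _ _ _ _ (cst 0) (@harmonic R)).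
  + apply: nearW => n; have /andP[-> _] /= := step_poly_ge0_le1 n t01.
    (* Since $2t\ge1$, the factor $1+n(2t)^n$ in [bernoulli_ge] is at least $n+1$. *)
    rewrite -[leRHS]mul1r ler_pdivlMr ?ltr0n//.
    apply: le_trans (bernoulli_ge (n * 2 ^ n) (tn n)).
    rewrite ler_wpM2l ?exprn_ge0 ?subr_ge0//; first by case/andP: (tn n).
    rewrite mE -natr1 addrC lerD2l ler_peMr// exprn_ege1//; lra.
  + exact: cvg_cst.
  + exact: cvg_harmonic.
Qed.

End StepApproximation.

(** * The identity as a limit of rescaled sines *)

Section SineScaling.
Context {R : realType}.
Local Open Scope classical_set_scope.
Implicit Types x y : R.

Lemma sin_mean_value y : exists2 c, `|c| <= `|y| & sin y = y * cos c.
Proof.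
wlog y_gt0 : y / 0 < y => [wlog_pos|].
  have [y0|y0|<-] := ltrgtP 0 y; first exact: wlog_pos.
    have [|c cy E] := wlog_pos (- y); first by rewrite oppr_gt0.
    exists c; first by rewrite -(normrN y).
    by apply: oppr_inj; rewrite -sinN E mulNr.
  by exists 0 => //; rewrite sin0 mul0r.
have [c cy] := @MVT R sin cos 0 y y_gt0 (fun x _ => is_derive_sin x)
  (continuous_subspaceT (@continuous_sin R)).
rewrite sin0 !subr0 mulrC => E; exists c => //.
by move: cy; rewrite in_itv /= => /andP[c0 cy]; rewrite !gtr0_norm// ltW.
Qed.

Lemma abs_sin_le y : `|sin y| <= `|y|.
Proof.
have [c _ ->] := sin_mean_value y.
by rewrite normrM ler_piMr// cos_max.
Qed.

Lemma sin_scaling_le (n : nat) y : `|n.+1%:R * sin (n.+1%:R^-1 * y)| <= `|y|.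
Proof.
rewrite normrM ger0_norm// -ler_pdivlMl//.
by apply: le_trans (abs_sin_le _) _; rewrite normrM gtr0_norm.
Qed.

(** By the mean value form of the sine, the sequence equals [y * cos (c n)] with
    $|c_n|\le|y|/(n+1)$. *)
Lemma sin_scaling_cvg y :
  (n.+1%:R * sin (n.+1%:R^-1 * y)) @[n --> \oo] --> y.
Proof.
pose h (n : nat) : R := n.+1%:R^-1 * y.
have /choice[c cP] : forall n, exists c, `|c| <= `|h n| /\ sin (h n) = h n * cos c.
  by move=> n; have [c ? ?] := sin_mean_value (h n); exists c.
have h0 : h n @[n --> \oo] --> 0.
  by rewrite -(mul0r y); apply: cvgM; [exact: cvg_harmonic|exact: cvg_cst].
have c0 : c n @[n --> \oo] --> 0.
  apply/norm_cvg0P; apply: (@squeeze_cvgr _ _ _ _ (cst 0) (fun n => `|h n|)).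
  - by apply: nearW => n; rewrite normr_ge0 /=; case: (cP n).
  - exact: cvg_cst.
  - by rewrite -(@normr0 _ R); exact: cvg_norm.
have -> : (fun n : nat => n.+1%:R * sin (n.+1%:R^-1 * y))
    = (fun n => y * cos (c n)).
  apply/funext => n; have [_ ->] := cP n; rewrite /h.
  by rewrite !mulrA divff ?mul1r.
rewrite -[X in _ --> X]mulr1 -cos0.
by apply: cvgM; [exact: cvg_cst|apply: (cvg_comp _ _ c0); exact: continuous_cos].
Qed.

End SineScaling.

(** * Uniqueness through sines and cosines *)

Section TrigMultipliers.
Context {d : measure_display} {Omega : measurableType d} {R : realType}.
Variable P : probability Omega R.
Variable H : set (Omega -> R).
Hypothesis mH : forall S, H S -> measurable_fun setT S.
Hypothesis HD : forall S T, H S -> H T -> H (fun w => S w + T w).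
Hypothesis HZ : forall r S, H S -> H (fun w => r * S w).
Local Open Scope classical_set_scope.
Local Notation L1 := (L1 P).
Local Notation Ex := (Ex P).
Implicit Types (xi k : Omega -> R) (A B : set Omega).

(** The condition $E[\xi e^{iS}]=0$ for all $S$ in [H], split into real and imaginary parts. *)
Definition trig_null xi := L1 xi /\ forall S, H S ->
  Ex (fun w => xi w * cos (S w)) = 0 /\ Ex (fun w => xi w * sin (S w)) = 0.

(* These functions form an algebra that is stable under bounded pointwise limits
   and contains the sines of [H], so the sets whose indicator is one of them
   form a sigma-algebra for which the functions of [H] are measurable. *)
Definition trig_mult k := bounded_mfun k /\
  forall xi, trig_null xi -> trig_null (fun w => xi w * k w).

Lemma L1_cos xi S : L1 xi -> H S -> L1 (fun w => xi w * cos (S w)).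
Proof. by move=> xi1 HS; exact: (L1M xi1 (bounded_mfun_cos (mH HS))). Qed.

Lemma L1_sin xi S : L1 xi -> H S -> L1 (fun w => xi w * sin (S w)).
Proof. by move=> xi1 HS; exact: (L1M xi1 (bounded_mfun_sin (mH HS))). Qed.

Lemma trig_nullD xi xi' : trig_null xi -> trig_null xi' ->
  trig_null (fun w => xi w + xi' w).
Proof.
move=> [i1 n] [i1' n']; split=> [|S HS]; first exact: L1D.
have [c s] := n _ HS; have [c' s'] := n' _ HS; split.
- under eq_Ex do rewrite mulrDl.
  by rewrite ExD ?c ?c' ?addr0//; exact: L1_cos.
- under eq_Ex do rewrite mulrDl.
  by rewrite ExD ?s ?s' ?addr0//; exact: L1_sin.
Qed.

Lemma trig_nullZ r xi : trig_null xi -> trig_null (fun w => r * xi w).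
Proof.
move=> [i1 n]; split=> [|S HS]; first exact: L1Z.
have [c s] := n _ HS; split.
- under eq_Ex do rewrite -mulrA.
  by rewrite ExZ ?c ?mulr0//; exact: L1_cos.
- under eq_Ex do rewrite -mulrA.
  by rewrite ExZ ?s ?mulr0//; exact: L1_sin.
Qed.

Lemma trig_null_cvg (xi_ : nat -> Omega -> R) xi g :
    (forall n, trig_null (xi_ n)) -> (forall w, xi_ ^~ w @ \oo --> xi w) ->
    L1 g -> (forall n w, `|xi_ n w| <= g w) ->
  trig_null xi.
Proof.
move=> n_ cxi g1 xig.
have mxi n : measurable_fun setT (xi_ n) by exact: (L1_measurable (n_ n).1).
split=> [|S HS]; first by have [] := Ex_cvg mxi cxi g1 xig.
split.
- have [|//|//||//|//] := @Ex_cvg0 _ _ _ P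
    (fun n w => xi_ n w * cos (S w)) (fun w => xi w * cos (S w)) g.
  + move=> n; exact: (L1_measurable (L1_cos (n_ n).1 HS)).
  + by move=> w; apply: cvgM; [exact: cxi|exact: cvg_cst].
  + move=> n w; rewrite normrM (le_trans _ (xig n w))//.
    by rewrite ler_piMr// cos_max.
  + by move=> n; case: (n_ n) => _ /(_ _ HS)[].
- have [|//|//||//|//] := @Ex_cvg0 _ _ _ P
    (fun n w => xi_ n w * sin (S w)) (fun w => xi w * sin (S w)) g.
  + move=> n; exact: (L1_measurable (L1_sin (n_ n).1 HS)).
  + by move=> w; apply: cvgM; [exact: cxi|exact: cvg_cst].
  + move=> n w; rewrite normrM (le_trans _ (xig n w))//.
    by rewrite ler_piMr// sin_max.
  + by move=> n; case: (n_ n) => _ /(_ _ HS)[].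
Qed.

Lemma eq_trig_mult k k' : (forall w, k w = k' w) -> trig_mult k -> trig_mult k'.
Proof. by move=> /funext->. Qed.

Lemma trig_mult_cst r : trig_mult (fun=> r).
Proof.
split; first exact: bounded_mfun_cst.
move=> xi /(trig_nullZ r); under eq_fun do rewrite mulrC; exact.
Qed.

Lemma trig_multD k k' : trig_mult k -> trig_mult k' ->
  trig_mult (fun w => k w + k' w).
Proof.
move=> [bk mk] [bk' mk']; split; first exact: bounded_mfunD.
move=> xi nxi; under eq_fun do rewrite mulrDr.
by apply: trig_nullD; [exact: mk|exact: mk'].
Qed.

Lemma trig_multM k k' : trig_mult k -> trig_mult k' ->
  trig_mult (fun w => k w * k' w).
Proof.
move=> [bk mk] [bk' mk']; split; first exact: bounded_mfunM.
move=> xi nxi; under eq_fun do rewrite mulrA.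
by apply: mk'; exact: mk.
Qed.

Lemma trig_multX k n : trig_mult k -> trig_mult (fun w => k w ^+ n).
Proof.
move=> mk; elim: n => [|n IHn].
  by apply: (eq_trig_mult _ (trig_mult_cst 1)) => w; rewrite expr0.
by apply: (eq_trig_mult _ (trig_multM mk IHn)) => w; rewrite exprS.
Qed.

Lemma trig_multZ r k : trig_mult k -> trig_mult (fun w => r * k w).
Proof. by move=> mk; exact: trig_multM (trig_mult_cst r) mk. Qed.

Lemma trig_mult_onem k : trig_mult k -> trig_mult (fun w => 1 - k w).
Proof.
move=> mk; apply: (eq_trig_mult _ (trig_multD (trig_mult_cst 1) (trig_multZ (-1) mk))).
by move=> w; rewrite mulN1r.
Qed.

Lemma trig_mult_cvg (k_ : nat -> Omega -> R) k M :
    (forall n, trig_mult (k_ n)) -> (forall w, k_ ^~ w @ \oo --> k w) ->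
    (forall n w, `|k_ n w| <= M) ->
  trig_mult k.
Proof.
move=> mk_ ck kM; have kM' w : `|k w| <= M.
  by apply: (ler_cvg_to (cvg_norm (ck w)) (cvg_cst M)); exact: nearW.
have mk n : measurable_fun setT (k_ n) := (mk_ n).1.1.
split; [split; last by exists M|].
  by apply: (@measurable_fun_cvg _ _ _ setT k_) => // w _; exact: ck.
move=> xi nxi.
apply: (@trig_null_cvg (fun n w => xi w * k_ n w) _ (fun w => M * `|xi w|)).
- by move=> n; apply: (mk_ n).2.
- by move=> w; apply: cvgM; [exact: cvg_cst|exact: ck].
- by apply: L1Z; case: nxi => xi1 _; exact: integrable_norm.
- by move=> n w; rewrite normrM mulrC ler_wpM2r.
Qed.

(** Product-to-sum formulas turn $\sin S\cos T$ and $\sin S\sin T$ into sines and cosines of $T\pm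
    S$, which are again in [H]. *)
Lemma trig_mult_sin S : H S -> trig_mult (sin \o S).
Proof.
move=> HS; split; first exact: (bounded_mfun_sin (mH HS)).
move=> xi [i1 nxi]; split.
  exact: L1_sin.
move=> T HT.
have HTS := HD HT HS.
have HTNS : H (fun w => T w + -1 * S w) by apply: HD => //; exact: HZ.
have [c s] := nxi _ HTS; have [c' s'] := nxi _ HTNS; split.
- under eq_Ex => w.
    rewrite (_ : _ * _ = 2^-1 * (xi w * sin (T w + S w) - xi w * sin (T w + -1 * S w))).
      over.
    by rewrite /= mulN1r !sinD cosN sinN; field.
  rewrite ExZ ?ExB ?s ?s' ?subrr ?mulr0//; try exact: L1_sin.
  by apply: L1B; exact: L1_sin.
- under eq_Ex => w.
    rewrite (_ : _ * _ = 2^-1 * (xi w * cos (T w + -1 * S w) - xi w * cos (T w + S w))).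
      over.
    by rewrite /= mulN1r !cosD cosN sinN; field.
  rewrite ExZ ?ExB ?c ?c' ?subrr ?mulr0//; try exact: L1_cos.
  by apply: L1B; exact: L1_cos.
Qed.

Definition trig_algebra : set (set Omega) :=
  [set A | measurable A /\ trig_mult \1_A].

(** On indicators, intersection is a product, difference is multiplication by [1 - \1_B], and
    increasing union is a bounded pointwise limit. *)
Lemma trig_algebra_sigma : sigma_algebra setT trig_algebra.
Proof.
apply/sigma_algebraP => //; split.
- split=> //; apply: (eq_trig_mult _ (trig_mult_cst 1)) => w.
  by rewrite indicE in_setT.
- move=> A B BA [mA kA] [mB kB]; split; first exact: measurableD.
  apply: (eq_trig_mult _ (trig_multM kA (trig_mult_onem kB))) => w.
  rewrite !indicE in_setD; case: (w \in A); case: (w \in B) => /=; ring.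
- move=> F ndF aF; split.
    by apply: bigcupT_measurable => n; case: (aF n).
  apply: (@trig_mult_cvg (fun n => \1_(F n)) _ 1).
  + by move=> n; case: (aF n).
  + move=> w; rewrite indicE.
    have [/set_mem[n _ Fn]|wF] := boolP (w \in _).
      apply: cvg_near_cst; exists n => // m /= nm; rewrite indicE mem_set//.
      by move: Fn; apply/subsetPset/ndF.
    apply: cvg_near_cst; apply: nearW => n; rewrite indicE.
    rewrite memNset// => Fn; move/negP: wF; apply; rewrite inE.
    by exists n.
  + by move=> n w; rewrite indicE; case: (w \in _); rewrite ?normr1 ?normr0.
- move=> A B [mA kA] [mB kB]; split; first exact: measurableI.
  apply: (eq_trig_mult _ (trig_multM kA kB)) => w.
  by rewrite !indicE in_setI; case: (w \in A); rewrite ?mul1r ?mul0r.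
Qed.

(** Rescale [k] affinely to [g] with values in $[0,1]$ so that the threshold [r] becomes [1/2]; then
    [step_poly n (g w)] are multipliers converging to the indicator. *)
Lemma trig_algebra_lt k r : trig_mult k -> trig_algebra [set w | k w < r].
Proof.
move=> mk; have [[mfk [M0 kM0]] _] := mk.
split.
  rewrite -[X in measurable X]setTI -[X in _ `&` X]/(k @^-1` [set x | x < r]).
  by apply: mfk => //; rewrite -set_itvNyo.
(* A positive bound on $|k-r|$, which keeps [g] within [1/2] of [1/2]. *)
pose M := `|M0| + `|r| + 1.
have M_gt0 : 0 < M by rewrite ltr_wpDl// addr_ge0.
pose g w := 2^-1 + (4 * M)^-1 * (k w - r).
have mg : trig_mult g.
  apply: trig_multD; first exact: trig_mult_cst.
  by apply: trig_multZ; apply: trig_multD => //; exact: trig_mult_cst.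
have g01 w : 0 <= g w <= 1.
  have : `|(4 * M)^-1 * (k w - r)| <= 2^-1.
    rewrite normrM gtr0_norm ?invr_gt0 ?mulr_gt0// ler_pdivrMl ?mulr_gt0//.
    apply: le_trans (ler_normB _ _) _.
    have := kM0 w; have := ler_norm M0; rewrite /M; have := normr_ge0 r.
    by have := normr_ge0 M0; lra.
  by rewrite ler_norml /g => /andP[? ?]; apply/andP; split; lra.
have gr w : (g w < 2^-1) = (k w < r).
  rewrite /g gtrDl pmulr_rlt0 ?subr_lt0// invr_gt0 mulr_gt0//.
apply: (@trig_mult_cvg (fun n w => step_poly n (g w)) _ 1).
- by move=> n; apply: trig_multX; apply: trig_mult_onem; exact: trig_multX.
- move=> w; have := step_poly_cvg (g01 w); rewrite gr.
  by rewrite indicE mem_setE.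
- move=> n w; have /andP[s0 s1] := step_poly_ge0_le1 n (g01 w).
  by rewrite ger0_norm.
Qed.

(** [S] is the pointwise limit of $(n+1)\sin(S/(n+1))$, whose sublevel sets are in the algebra. The
    type [T] carries [trig_algebra] as its measurable sets, so measurability passes to the limit. *)
Lemma trig_algebra_preimage S (B : set R) : H S -> measurable B ->
  trig_algebra (S @^-1` B).
Proof.
move=> HS mB; pose T := g_sigma_algebraType trig_algebra.
have TE : @measurable _ T = trig_algebra.
  exact: measurable_g_measurableTypeE trig_algebra_sigma.
pose f (n : nat) : T -> R := fun w => n.+1%:R * sin (n.+1%:R^-1 * S w).
have mf n : measurable_fun setT (f n).
  apply: (measurability _ (RGenInftyO.measurableE R)) => _ [_ [r ->] <-].
  rewrite setTI TE set_itvNyo; apply: trig_algebra_lt.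
  apply: trig_multZ.
  by apply: (eq_trig_mult _ (trig_mult_sin (HZ n.+1%:R^-1 HS))).
have mS : measurable_fun setT (S : T -> R).
  apply: (@measurable_fun_cvg _ _ _ setT f) => // w _.
  exact: sin_scaling_cvg.
by have := mS measurableT B mB; rewrite setTI TE.
Qed.

(** Test the product of [xi] and [\1_A] against the cosine of the zero function. *)
Lemma trig_null_indic xi A : H (fun=> 0) -> trig_null xi -> trig_algebra A ->
  Ex (fun w => xi w * \1_A w) = 0.
Proof.
move=> H0 nxi [_ [_ /(_ _ nxi)[_ /(_ _ H0)[+ _]]]].
by under eq_Ex do rewrite cos0 mulr1.
Qed.

End TrigMultipliers.

(** * From orthogonality to indicators to orthogonality to measurable functions *)

Section PullOut.
Import HBNNSimple.
Context {d : measure_display} {Omega : measurableType d} {R : realType}.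
Variable P : probability Omega R.
Local Open Scope classical_set_scope.
Local Notation L1 := (L1 P).
Local Notation Ex := (Ex P).
Implicit Types (xi k : Omega -> R) (A : set Omega) (G : set (set Omega)).

(** Stated with bare preimages because [G] differs from the measurable structure carried by the type
    [Omega]. *)
Definition measurable_wrt G k := forall B : set R, measurable B -> G (k @^-1` B).

Lemma Ex_sum_eq0 (I : eqType) (s : seq I) (f : I -> Omega -> R) :
    (forall i, i \in s -> L1 (f i) /\ Ex (f i) = 0) ->
  L1 (fun w => \sum_(i <- s) f i w) /\ Ex (fun w => \sum_(i <- s) f i w) = 0.
Proof.
elim: s => [_|i s IHs fP].
  have -> : (fun w => \sum_(i <- [::]) f i w) = fun=> 0.
    by apply/funext => w; rewrite big_nil.
  by split; [exact/bounded_L1/bounded_mfun_cst|rewrite /Ex Rintegral_cst// mul0r].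
have [|s1 s0] := IHs; first by move=> j js; apply: fP; rewrite inE js orbT.
have [i1 i0] := fP i (mem_head i s).
have -> : (fun w => \sum_(j <- i :: s) f j w)
    = fun w => f i w + \sum_(j <- s) f j w.
  by apply/funext => w; rewrite big_cons.
by split; [exact: L1D|rewrite ExD// i0 s0 addr0].
Qed.

(** Approximate [k] from below by simple functions, with [xi * k] as dominating function. *)
Lemma pull_out_ge0 G xi k : L1 xi -> measurable_fun setT k ->
    (forall w, 0 <= k w) -> measurable_wrt G k -> L1 (fun w => xi w * k w) ->
    (forall A, G A -> Ex (fun w => xi w * \1_A w) = 0) ->
  Ex (fun w => xi w * k w) = 0.
Proof.
move=> xi1 mk k0 Gk xik1 xi0.
(* The approximation is made on the real line and then composed with [k], so that its level sets are
   preimages under [k] and hence lie in [G]. The maximum makes [f] nonnegative on the whole line. *)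
pose f (x : R) := (Num.max x 0)%:E.
have mf : measurable_fun setT f.
  by apply/measurable_EFinP; apply: measurable_maxr.
have f0 x : setT x -> (0 <= f x)%E by rewrite lee_fin le_max lexx orbT.
have fk w : f (k w) = (k w)%:E by rewrite /f max_l.
pose h := nnsfun_approx measurableT mf.
have hle n w : 0 <= h n (k w) <= k w.
  by rewrite fun_ge0 /= -lee_fin -fk /h nnsfun_approxE le_approx.
have mhk n : measurable_fun setT (h n \o k) by exact: measurableT_comp.
have mxi := L1_measurable xi1.
have [|||||//] := @Ex_cvg0 _ _ _ P (fun n w => xi w * h n (k w))
  (fun w => xi w * k w) (fun w => `|xi w * k w|).
- by move=> n; exact: (measurable_funM mxi (mhk n)).
- move=> w; apply: cvgM; first exact: cvg_cst.
  have := cvg_nnsfun_approx measurableT mf f0 (x := k w) I.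
  by rewrite fk => /fine_cvg.
- exact: integrable_norm.
- move=> n w; rewrite !normrM ler_wpM2l//.
  by have /andP[h0 hk] := hle n w; rewrite !ger0_norm.
- move=> n; pose s := finmap.enum_fset (fset_set (range (h n))).
  have hE w : xi w * h n (k w) = \sum_(y <- s)
      y * (xi w * \1_(k @^-1` (h n @^-1` [set y])) w).
    rewrite fimfunE fsbig_finite//= mulr_sumr; apply: eq_bigr => y _.
    by rewrite mulrCA !indicE.
  rewrite (eq_Ex _ hE); apply: (Ex_sum_eq0 _).2 => y _.
  have mA : measurable (h n @^-1` [set y]) by exact: measurable_sfunP.
  have i1 : L1 (fun w => xi w * \1_(k @^-1` (h n @^-1` [set y])) w).
    apply: L1M => //; apply: bounded_mfun_indic.
    by rewrite -[X in measurable X]setTI; exact: mk.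
  split; first exact: L1Z.
  by rewrite ExZ// xi0 ?mulr0//; exact: Gk.
Qed.

Lemma pull_out G xi k : L1 xi -> measurable_fun setT k ->
    measurable_wrt G k -> L1 (fun w => xi w * k w) ->
    (forall A, G A -> Ex (fun w => xi w * \1_A w) = 0) ->
  Ex (fun w => xi w * k w) = 0.
Proof.
move=> xi1 mk Gk xik1 xi0; have mxi := L1_measurable xi1.
have part (m : R -> R) : measurable_fun setT m -> (forall x, 0 <= m x <= `|x|) ->
    L1 (fun w => xi w * m (k w)) /\ Ex (fun w => xi w * m (k w)) = 0.
  move=> mm m0; have mmk : measurable_fun setT (m \o k) by exact: measurableT_comp.
  have i1 : L1 (fun w => xi w * m (k w)).
    apply: L1_le xik1 _; first exact: (measurable_funM mxi mmk).
    by move=> w; rewrite !normrM ler_wpM2l//; have /andP[? ?] := m0 (k w);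
      rewrite ger0_norm.
  split=> //; apply: (@pull_out_ge0 G xi (m \o k)) => //.
    by move=> w; case/andP: (m0 (k w)).
  move=> B mB; rewrite comp_preimage; apply: Gk.
  by rewrite -[X in measurable X]setTI; exact: mm.
have [||p1 p0] := part (fun x => Num.max x 0).
- exact: measurable_maxr.
- by move=> x; rewrite le_max lexx orbT ge_max ler_norm normr_ge0.
have [||n1 n0] := part (fun x => Num.max (- x) 0).
- by apply: measurable_maxr => //; exact: measurable_oppr.
- by move=> x; rewrite le_max lexx orbT ge_max normr_ge0 ler_normr lexx orbT.
have -> : Ex (fun w => xi w * k w) =
    Ex (fun w => xi w * Num.max (k w) 0 - xi w * Num.max (- k w) 0).
  apply: eq_Ex => w; rewrite -mulrBr; congr (_ * _).
  have /orP[k0|k0] := le_total 0 (k w).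
    by rewrite max_l// max_r ?subr0// oppr_le0.
  by rewrite max_r// max_l ?sub0r ?opprK// oppr_ge0.
by rewrite ExB// p0 n0 subrr.
Qed.

End PullOut.

(** * Conditional independence *)

Section ConditionalIndependence.
Context {d : measure_display} {Omega : measurableType d} {R : realType}.
Variable P : probability Omega R.
Local Open Scope classical_set_scope.
Local Notation L1 := (L1 P).
Local Notation Ex := (Ex P).
Implicit Types (f g k U V M : Omega -> R) (A B C : set Omega).
Implicit Types (G : set (set Omega)).

Lemma Ex_ge0 f : (forall w, 0 <= f w) -> 0 <= Ex f.
Proof. by move=> f0; exact: Rintegral_ge0. Qed.

Lemma Ex_le f g : L1 f -> L1 g -> (forall w, f w <= g w) -> Ex f <= Ex g.
Proof. by move=> f1 g1 fg; apply: le_Rintegral. Qed.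

Lemma Ex_indicM f A : Ex (fun w => f w * \1_A w) = \int[P]_(w in A) f w.
Proof.
rewrite Rintegral_mkcond; apply: eq_Ex => w.
by rewrite patchE indicE; case: ifP; rewrite ?mulr1 ?mulr0.
Qed.

Lemma Ex_ae f g : measurable_fun setT g -> L1 f ->
  {ae P, forall w, f w = g w} -> L1 g /\ Ex g = Ex f.
Proof.
move=> mg f1 fg; have mf := L1_measurable f1.
have aefg : ae_eq P setT (EFin \o f) (EFin \o g).
  by apply: filterS fg => w E _ /=; rewrite E.
split; last first.
  congr fine; apply/esym; apply: ae_eq_integral => //; exact/measurable_EFinP.
apply/integrableP; split; first exact/measurable_EFinP.
move/integrableP: f1 => [_]; rewrite (ae_eq_integral (abse \o (EFin \o g)))//.
- by apply: measurableT_comp => //; exact/measurable_EFinP.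
- by apply: measurableT_comp => //; exact/measurable_EFinP.
- by apply: filterS aefg => w E /E /= [->].
Qed.

Lemma cond_prob_orth G A f C : measurable A -> (forall B, G B -> measurable B) ->
    cond_prob P G A f -> G C ->
  L1 f /\ Ex (fun w => (\1_A w - f w) * \1_C w) = 0.
Proof.
move=> mA Gm [_ f1 fE] GC; split=> //; have mC := Gm _ GC.
have bC : bounded_mfun (\1_C : Omega -> R) by exact: bounded_mfun_indic.
have A1 : L1 \1_A by exact/bounded_L1/bounded_mfun_indic.
under eq_Ex do rewrite mulrBl.
rewrite ExB; [|exact: (L1M A1 bC)|exact: (L1M f1 bC)].
rewrite !Ex_indicM {2}/Rintegral fE//.
by rewrite /Rintegral integral_indic// setIC subrr.
Qed.

Lemma measurable_wrt_measurable G f : (forall B, G B -> measurable B) ->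
  measurable_wrt G f -> measurable_fun setT f.
Proof. by move=> Gm Gf _ B mB; rewrite setTI; exact/Gm/Gf. Qed.

Lemma measurable_wrtP G f : sigma_algebra setT G ->
  measurable_wrt G f <->
  measurable_fun setT (f : g_sigma_algebraType G -> R).
Proof.
move=> sG; have E := measurable_g_measurableTypeE sG; split=> mf.
  by move=> _ B mB; rewrite setTI E; exact: mf.
by move=> B mB; have := mf measurableT B mB; rewrite setTI E.
Qed.

(* Truncating a version of [P(A | G)] to [0, 1] changes no integral over a
   set of [G]: its excess over [0, 1] has the wrong sign on [G]-sets. *)
Lemma cond_prob_bounded G A f : sigma_algebra setT G ->
    (forall B, G B -> measurable B) -> measurable A -> cond_prob P G A f ->
  exists k, [/\ bounded_mfun k, measurable_wrt G k
    & forall C, G C -> Ex (fun w => (\1_A w - k w) * \1_C w) = 0].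
Proof.
move=> sG Gm mA fP; have [Gf f1 _] := fP.
pose c (x : R) := Num.min (Num.max x 0) 1.
have c01 x : 0 <= c x <= 1.
  by rewrite /c le_min le_max lexx orbT ler01 ge_min lexx orbT.
have mc : measurable_fun setT c.
  by apply: measurable_minr => //; exact: measurable_maxr.
have mf := L1_measurable f1.
have mcf : measurable_fun setT (c \o f) by exact: measurableT_comp.
have bk : bounded_mfun (c \o f).
  by split=> //; exists 1 => w; case/andP: (c01 (f w)) => ? ?; rewrite ger0_norm.
exists (c \o f); split=> //.
  move=> B mB; rewrite comp_preimage; apply: Gf.
  by rewrite -[X in measurable X]setTI; exact: mc.
have GI B C : G B -> G C -> G (B `&` C).
  by have [_ _ _ +] := (sigma_algebraP (fun _ _ => @subsetT _ _)).1 sG; apply.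
have A1 : L1 \1_A by exact/bounded_L1/bounded_mfun_indic.
have cf1 := bounded_L1 P bk.
have fc1 := L1B f1 cf1; have fA1 := L1B f1 A1.
have bC B : G B -> bounded_mfun (\1_B : Omega -> R).
  by move=> GB; exact/bounded_mfun_indic/Gm.
(* [s] is the sign of the excess on [S]. The signed excess lies between [0] and [s * (f - \1_A)],
   whose integral over a set of [G] is zero. *)
have null (S : set R) (s : R) C : s != 0 -> measurable S -> G C ->
    (forall w, S (f w) -> 0 <= s * (f w - c (f w)) <= s * (f w - \1_A w)) ->
  L1 (fun w => (f w - c (f w)) * \1_(f @^-1` S `&` C) w) /\
  Ex (fun w => (f w - c (f w)) * \1_(f @^-1` S `&` C) w) = 0.
  move=> s0 mS GC sS; have GD : G (f @^-1` S `&` C) by apply: GI => //; exact: Gf.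
  set D := f @^-1` S `&` C in GD *.
  have fcD := L1M fc1 (bC _ GD); have fAD := L1M fA1 (bC _ GD).
  split=> //; apply: (mulfI s0); rewrite mulr0 -ExZ//; apply/eqP; rewrite eq_le.
  apply/andP; split; last first.
    apply: Ex_ge0 => w; rewrite mulrA indicE.
    case: (boolP (w \in D)) => [/set_mem[Sf _]|_]; last by rewrite mulr0.
    by rewrite mulr1; case/andP: (sS w Sf).
  have <- : Ex (fun w => s * ((f w - \1_A w) * \1_D w)) = 0.
    have -> : Ex (fun w => s * ((f w - \1_A w) * \1_D w))
        = Ex (fun w => - s * ((\1_A w - f w) * \1_D w)).
      by apply: eq_Ex => w; ring.
    by rewrite ExZ ?(cond_prob_orth mA Gm fP GD).2 ?mulr0//; apply: L1M (bC _ GD); exact: L1B.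
  apply: Ex_le; [exact: L1Z|exact: L1Z|] => w.
  rewrite !mulrA indicE; case: (boolP (w \in D)) => [/set_mem[Sf _]|_].
    by rewrite !mulr1; case/andP: (sS w Sf).
  by rewrite !mulr0.
move=> C GC.
have [||//||n0 n0E] := null [set x | x < 0] (-1) C; first by rewrite oppr_eq0 oner_eq0.
- by rewrite -set_itvNyo.
- move=> w /= fw0; have -> : c (f w) = 0.
    by rewrite /c (max_r (ltW fw0)) min_l// ler01.
  have : 0 <= \1_A w :> R by rewrite indicE.
  by move=> ?; apply/andP; split; lra.
have [||//||n1 n1E] := null [set x | 1 < x] 1 C; first exact: oner_neq0.
- by rewrite -set_itvoy.
- move=> w /= fw1; have -> : c (f w) = 1.
    by rewrite /c max_l ?min_r ?ltW// (lt_trans _ fw1).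
  have : \1_A w <= 1 :> R by rewrite indicE lern1 leq_b1.
  by move=> ?; apply/andP; split; lra.
have E0 := (cond_prob_orth mA Gm fP GC).2.
have i0 : L1 (fun w => (\1_A w - f w) * \1_C w).
  by apply: L1M; [exact: L1B|exact: bC].
(* On [C], the function [\1_A - c \o f] is [\1_A - f] plus the excess below [0] and the excess above
   [1]. *)
have := ExD i0 (L1D n0 n1); rewrite (ExD n0 n1) E0 n0E n1E !addr0 => <-.
apply: eq_Ex => w; rewrite !indicE !in_setI.
have [wC|wC] := boolP (w \in C); last by rewrite !andbF !mulr0 !addr0.
rewrite !andbT !mulr1; have -> : (w \in f @^-1` [set x | x < 0]) = (f w < 0).
  by rewrite mem_setE.
have -> : (w \in f @^-1` [set x | 1 < x]) = (1 < f w) by rewrite mem_setE.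
rewrite /= /c; have [f0|f0] := ltP (f w) 0.
  by rewrite (lt_gtF (lt_trans f0 ltr01)) min_l ?ler01//=; ring.
have [f2|f2] := ltP 1 (f w); first by rewrite /=; ring.
by rewrite /=; ring.
Qed.

(** Given [G], the events of [G2] bring no further information on [A]:
    $E[1_A1_B]=E[h]=E[fg]=E[1_Ag]=E[kg]=E[k1_B]$. *)
Lemma cond_indep_project G1 G2 G A : sigma_algebra setT G ->
    (forall B, G B -> measurable B) -> (forall B, G2 B -> measurable B) ->
    G2 setT -> measurable A -> G1 A -> cond_indep P G1 G2 G ->
  exists k, [/\ bounded_mfun k, measurable_wrt G k,
    forall C, G C -> Ex (fun w => (\1_A w - k w) * \1_C w) = 0
    & forall B, G2 B -> Ex (fun w => (\1_A w - k w) * \1_B w) = 0].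
Proof.
move=> sG Gm G2m G2T mA G1A ci.
(* The versions supplied by [ci] depend on [B], so [k] is fixed beforehand from the case
   [B = setT]. *)
have [f0 [_ [_ [f0P _ _ _]]]] := ci A setT G1A G2T.
have [k [bk Gk kA]] := cond_prob_bounded sG Gm mA f0P.
exists k; split=> // B G2B; have mB := G2m _ G2B.
have [f [g [h [fP gP hP hfg]]]] := ci A B G1A G2B.
have mfg f' B' : cond_prob P G B' f' -> measurable_wrt G f' /\ measurable_fun setT f'.
  by case=> Gf' _ _; split=> //; exact: measurable_wrt_measurable Gm Gf'.
have [Gf mf] := mfg _ _ fP; have [Gg mg] := mfg _ _ gP.
have GT : G setT by have [+ _ _ _] := (sigma_algebraP (fun _ _ => @subsetT _ _)).1 sG.
have mAB : measurable (A `&` B) by exact: measurableI.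
have f1 := (cond_prob_orth mA Gm fP GT).1.
have g1 := (cond_prob_orth mB Gm gP GT).1.
have [h1 hE] := cond_prob_orth mAB Gm hP GT.
have bA : bounded_mfun (\1_A : Omega -> R) by exact: bounded_mfun_indic.
have bB : bounded_mfun (\1_B : Omega -> R) by exact: bounded_mfun_indic.
have bAB : bounded_mfun (\1_(A `&` B) : Omega -> R) by exact: bounded_mfun_indic.
(* Integrability of [f * g] is inherited from [h], since neither factor is known to be bounded. *)
have [fg1 fgE] := Ex_ae (measurable_funM mf mg) h1 hfg.
have k1 := bounded_L1 P bk.
have A1 := bounded_L1 P bA; have B1 := bounded_L1 P bB.
have gA1 := L1M g1 bA; have gk1 := L1M g1 bk.
have Ag1 : L1 (fun w => \1_A w * g w) by under eq_fun do rewrite mulrC.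
have kg1 : L1 (fun w => k w * g w) by under eq_fun do rewrite mulrC.
have EAB : Ex (fun w => \1_A w * \1_B w) = Ex h.
  have ABE w : \1_A w * \1_B w = \1_(A `&` B) w :> R.
    by rewrite !indicE in_setI; case: (w \in A); rewrite ?mul1r ?mul0r.
  rewrite (eq_Ex _ ABE); apply/eqP; rewrite -subr_eq0 -ExB//; last first.
    exact: bounded_L1.
  rewrite -[X in _ == X]hE; apply/eqP/eq_Ex => w.
  by rewrite [X in _ * X]indicE in_setT mulr1.
have E1 : Ex (fun w => (\1_A w - f w) * g w) = 0.
  apply: (@pull_out _ _ _ P G) => //.
  - exact: L1B.
  - by under eq_fun do rewrite mulrBl; exact: L1B.
  - by move=> C GC; case: (cond_prob_orth mA Gm fP GC).
have E2 : Ex (fun w => (\1_A w - k w) * g w) = 0.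
  apply: (@pull_out _ _ _ P G) => //.
  - exact: L1B.
  - by under eq_fun do rewrite mulrBl; exact: L1B.
have E3 : Ex (fun w => (\1_B w - g w) * k w) = 0.
  apply: (@pull_out _ _ _ P G) => //.
  - exact: L1B.
  - exact: bk.1.
  - by apply: L1M => //; exact: L1B.
  - by move=> C GC; case: (cond_prob_orth mB Gm gP GC).
have Bk1 := L1M B1 bk; have AB1 := L1M A1 bB; have kB1 := L1M k1 bB.
move: E1 E2 E3; under eq_Ex do rewrite mulrBl; rewrite ExB// => E1.
under eq_Ex do rewrite mulrBl; rewrite ExB// => E2.
under eq_Ex do rewrite mulrBl; rewrite ExB// => E3.
under eq_Ex do rewrite mulrBl; rewrite ExB//.
have kBE : Ex (fun w => \1_B w * k w) = Ex (fun w => k w * \1_B w).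
  by apply: eq_Ex => w; rewrite mulrC.
have gkE : Ex (fun w => g w * k w) = Ex (fun w => k w * g w).
  by apply: eq_Ex => w; rewrite mulrC.
by rewrite kBE gkE in E3; rewrite EAB; move: fgE E1 E2 E3; lra.
Qed.

(** For [A] in [G1] with projection [k], write $E[(V-M)1_A]=E[(1_A-k)V]-E[(1_A-k)M]+E[(V-M)k]$. The
    terms vanish by orthogonality of [\1_A - k] to [G2] and to [G], and of [V - M] to [G]. *)
Lemma cond_indep_orth G1 G2 G U V M : sigma_algebra setT G ->
    (forall B, G1 B -> measurable B) -> (forall B, G2 B -> measurable B) ->
    (forall B, G B -> measurable B) -> G2 setT -> cond_indep P G1 G2 G ->
    measurable_wrt G1 U -> measurable_wrt G2 V -> measurable_wrt G M ->
    L1 V -> L1 M -> L1 (fun w => (V w - M w) * U w) ->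
    (forall C, G C -> Ex (fun w => (V w - M w) * \1_C w) = 0) ->
  Ex (fun w => (V w - M w) * U w) = 0.
Proof.
move=> sG G1m G2m Gm G2T ci GU GV GM V1 M1 VMU1 VMG.
have VM1 := L1B V1 M1.
apply: (@pull_out _ _ _ P G1) => //.
  exact: measurable_wrt_measurable GU.
move=> A G1A; have mA := G1m _ G1A.
have [k [bk Gk kG kG2]] := cond_indep_project sG Gm G2m G2T mA G1A ci.
have bA : bounded_mfun (\1_A : Omega -> R) by exact: bounded_mfun_indic.
have k1 := bounded_L1 P bk; have A1 := bounded_L1 P bA.
have Ak1 := L1B A1 k1.
have bAk : bounded_mfun (fun w => \1_A w - k w).
  under eq_fun do rewrite -mulN1r.
  by apply: bounded_mfunD => //; apply: bounded_mfunM => //; exact: bounded_mfun_cst.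
have E1 : Ex (fun w => (\1_A w - k w) * V w) = 0.
  apply: (@pull_out _ _ _ P G2) => //; first exact: measurable_wrt_measurable GV.
  by under eq_fun do rewrite mulrC; exact: L1M.
have E2 : Ex (fun w => (\1_A w - k w) * M w) = 0.
  apply: (@pull_out _ _ _ P G) => //; first exact: measurable_wrt_measurable GM.
  by under eq_fun do rewrite mulrC; exact: L1M.
have E3 : Ex (fun w => (V w - M w) * k w) = 0.
  by apply: (@pull_out _ _ _ P G) => //; [exact: bk.1|exact: L1M].
have -> : Ex (fun w => (V w - M w) * \1_A w) = Ex (fun w =>
    ((\1_A w - k w) * V w - (\1_A w - k w) * M w) + (V w - M w) * k w).
  by apply: eq_Ex => w; ring.
have i1 : L1 (fun w => (\1_A w - k w) * V w).
  by under eq_fun do rewrite mulrC; exact: L1M.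
have i2 : L1 (fun w => (\1_A w - k w) * M w).
  by under eq_fun do rewrite mulrC; exact: L1M.
by rewrite ExD ?ExB ?E1 ?E2 ?E3 ?subr0 ?addr0//; [exact: L1B|exact: L1M].
Qed.

End ConditionalIndependence.

(** * Gaussian vectors *)

Section GaussianVectors.
Context {d : measure_display} {Omega : measurableType d} {R : realType}.
Context {P : probability Omega R} {V : finType}.
Context {X : V -> {RV P >-> R}} {mu : V -> R} {Sigma : V -> V -> R}.
Hypothesis gX : gaussian_vector X mu Sigma.
Hypothesis pd : posdef Sigma.
Local Open Scope classical_set_scope.
Local Notation L1 := (L1 P).
Local Notation Ex := (Ex P).
Implicit Types (r s t : V -> R) (Z : {set V}).

Definition lin_comb t (w : Omega) : R := \sum_v t v * X v w.
Definition mean t : R := \sum_v t v * mu v.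
Definition centered t (w : Omega) : R := lin_comb t w - mean t.

Lemma measurable_lin_comb t : measurable_fun setT (lin_comb t).
Proof.
by apply: measurable_sum => v; apply: measurable_funM => //; exact: measurable_funP.
Qed.

Lemma measurable_centered t : measurable_fun setT (centered t).
Proof. by apply: measurable_funB => //; exact: measurable_lin_comb. Qed.

Lemma lin_combD s t w :
  lin_comb (fun v => s v + t v) w = lin_comb s w + lin_comb t w.
Proof. by rewrite -big_split; apply: eq_bigr => v _; rewrite mulrDl. Qed.

Lemma lin_combZ k t w : lin_comb (fun v => k * t v) w = k * lin_comb t w.
Proof. by rewrite /lin_comb mulr_sumr; apply: eq_bigr => v _; rewrite mulrA. Qed.

Lemma meanD s t : mean (fun v => s v + t v) = mean s + mean t.
Proof. by rewrite -big_split; apply: eq_bigr => v _; rewrite mulrDl. Qed.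

Lemma meanZ k t : mean (fun v => k * t v) = k * mean t.
Proof. by rewrite /mean mulr_sumr; apply: eq_bigr => v _; rewrite mulrA. Qed.

Lemma centeredD s t w :
  centered (fun v => s v + t v) w = centered s w + centered t w.
Proof. by rewrite /centered lin_combD meanD; ring. Qed.

Lemma centeredZ k t w : centered (fun v => k * t v) w = k * centered t w.
Proof. by rewrite /centered lin_combZ meanZ; ring. Qed.

Lemma ge0_integral_lin_comb t (f : R -> R) : (exists v, t v != 0) ->
    (forall x, 0 <= f x) -> continuous f ->
  (\int[P]_w (f (lin_comb t w))%:E
   = \int[normal_prob 0 1]_x (f (Num.sqrt (quad_form Sigma t) * x + mean t))%:E)%E.
Proof.
move=> t0 f0 cf.
have q0 : 0 < Num.sqrt (quad_form Sigma t) by rewrite sqrtr_gt0; exact: pd.2.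
rewrite -normal_prob_affine//.
pose Y : {RV P >-> measurableTypeR R} := HB.pack (lin_comb t)
  (isMeasurableFun.Build _ _ Omega (measurableTypeR R) _ (measurable_lin_comb t)).
have mf : measurable_fun setT f by exact: continuous_measurable_fun.
rewrite -[LHS](@ge0_integral_distribution _ _ _ _ _ P Y (EFin \o f)).
- by apply: eq_measure_integral => B mB _; exact: gX.
- exact/measurable_EFinP.
- by move=> x; rewrite lee_fin.
Qed.

(** Kept as an unevaluated positive factor in all second moments; a covariance vanishes as soon as
    its multiple by [kappa] does. *)
Definition kappa : R := fine (\int[normal_prob 0 1]_x (x ^+ 2 : R)%:E)%E.

Lemma kappa_gt0 : 0 < kappa.
Proof.
by rewrite fine_gt0// normal_second_moment_gt0 normal_second_moment_fin.
Qed.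

Lemma centered_sq t : L1 (fun w => centered t w ^+ 2) /\
  Ex (fun w => centered t w ^+ 2) = quad_form Sigma t * kappa.
Proof.
have msq : measurable_fun setT (fun w => centered t w ^+ 2).
  by apply: measurable_funX; exact: measurable_centered.
suff E : (\int[P]_w (centered t w ^+ 2)%:E = (quad_form Sigma t * kappa)%:E)%E.
  split; last by rewrite /Ex /Rintegral E.
  apply/integrableP; split; first exact/measurable_EFinP.
  under eq_integral do rewrite gee0_abs ?lee_fin ?sqr_ge0//.
  by rewrite E ltry.
(* [gaussian_vector] speaks of nonzero combinations only; for [t = 0] both sides are zero. *)
have [t0|t0] := pselect (exists v, t v != 0); last first.
  have tE v : t v = 0 by apply/eqP/negPn/negP => tv; apply: t0; exists v.
  have -> : quad_form Sigma t = 0.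
    by rewrite /quad_form big1// => u _; rewrite big1// => v _; rewrite tE !mul0r.
  rewrite mul0r; apply: integral0_eq => w _.
  rewrite /centered /lin_comb /mean !big1 ?subr0 ?expr0n// => v _;
    by rewrite tE mul0r.
have q0 : 0 < quad_form Sigma t by exact: pd.2.
rewrite (@ge0_integral_lin_comb t (fun x => (x - mean t) ^+ 2))//; last 2 first.
- by move=> x; exact: sqr_ge0.
- move=> x; apply: (@continuous_comp _ _ _ (fun x => x - mean t) (fun x => x ^+ 2)).
    by apply: cvgB; [exact: cvg_id|exact: cvg_cst].
  exact: exprn_continuous.
under eq_integral => x _.
  rewrite addrK exprMn sqr_sqrtr ?(ltW q0)// EFinM; over.
have mX2 : measurable_fun setT (fun x : R => x ^+ 2) by exact: measurable_funX.
rewrite ge0_integralZl//; last first.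
- by rewrite lee_fin ltW.
- by move=> x _; rewrite lee_fin sqr_ge0.
- exact/measurable_EFinP.
rewrite EFinM /kappa fineK// ge0_fin_numE ?normal_second_moment_fin//.
exact/ltW/normal_second_moment_gt0.
Qed.

Lemma centered_L1 t : L1 (centered t).
Proof.
have one : L1 (fun=> 1) by exact/bounded_L1/bounded_mfun_cst.
apply: L1_le (measurable_centered t) (L1D one (centered_sq t).1) _ => w.
rewrite [leRHS]ger0_norm ?addr_ge0 ?sqr_ge0//; set x := centered t w.
by rewrite ler_norml; apply/andP; split; nra.
Qed.

(** Polarization of [centered_sq]. *)
Lemma centered_prod s t : L1 (fun w => centered s w * centered t w) /\
  Ex (fun w => centered s w * centered t w) = bilin Sigma s t * kappa.
Proof.
pose p v := s v + t v; pose m v := s v + -1 * t v.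
have [p1 pE] := centered_sq p; have [m1 mE] := centered_sq m.
have E w : centered s w * centered t w
    = 4^-1 * (centered p w ^+ 2 - centered m w ^+ 2).
  by rewrite /p /m !centeredD centeredZ; field.
split; first by under eq_fun do rewrite E; apply: L1Z; exact: L1B.
rewrite (eq_Ex _ E) ExZ ?ExB ?pE ?mE//; last exact: L1B.
rewrite !quad_formE /p /m.
by rewrite !bilinDr// !bilinDl !bilinZr// !bilinZl (bilin_sym t s pd); field.
Qed.

End GaussianVectors.

(** * Markov property and partial covariances *)

Section GaussianMarkov.
Context {d : measure_display} {Omega : measurableType d} {R : realType}.
Context {P : probability Omega R} {V : finType}.
Context {X : V -> {RV P >-> R}} {mu : V -> R} {Sigma : V -> V -> R}.
Hypothesis gX : gaussian_vector X mu Sigma.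
Hypothesis pd : posdef Sigma.
Local Open Scope classical_set_scope.
Local Notation L1 := (L1 P).
Local Notation Ex := (Ex P).
Local Notation lin_comb := (@lin_comb _ _ _ P _ X).
Local Notation centered := (@centered _ _ _ P _ X mu).
Implicit Types (r s t : V -> R) (Z : {set V}).

(* [s + t r] and [s - t r] have the same variance since [s] and [r] are
   uncorrelated, hence so do the corresponding combinations of [X], up to a
   translation making their means equal. *)
Lemma Ex_reflect (g : R -> R) r s (t : R) : continuous g -> (forall x, `|g x| <= 1) ->
    bilin Sigma r s = 0 -> (exists v, s v = 0 /\ r v != 0) -> t != 0 ->
  Ex (fun w => g (lin_comb s w + t * centered r w))
  = Ex (fun w => g (lin_comb s w - t * centered r w)).
Proof.
move=> cg g1 rs [v [sv rv]] t0.
pose q := quad_form Sigma s + t ^+ 2 * quad_form Sigma r.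
have one : L1 (fun=> 1) by exact/bounded_L1/bounded_mfun_cst.
have mcomb k : measurable_fun setT (fun w => lin_comb s w + k * centered r w).
  apply: measurable_funD; first exact: measurable_lin_comb.
  by apply: measurable_funM => //; exact: measurable_centered.
have gcomb k : bounded_mfun (fun w => g (lin_comb s w + k * centered r w)).
  by apply: (bounded_mfun_comp (mcomb k) cg); exists 1.
(* Adding [1] makes the integrand nonnegative. The right side does not depend on [k], so [t] and
   [- t] give the same value. *)
have key k : k ^+ 2 = t ^+ 2 ->
    Ex (fun w => 1 + g (lin_comb s w + k * centered r w))
    = fine (\int[normal_prob 0 1]_x (1 + g (Num.sqrt q * x + mean (mu := mu) s))%:E)%E.
  move=> kt; pose p v := s v + k * r v.
  have k0 : k != 0 by rewrite -sqrf_eq0 kt sqrf_eq0.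
  have pq : quad_form Sigma p = q.
    rewrite /q -kt !quad_formE /p.
    rewrite !bilinDr// !bilinDl !bilinZr// !bilinZl (bilin_sym s r pd) rs.
    by ring.
  pose f x := 1 + g (x - k * mean (mu := mu) r).
  congr fine; transitivity (\int[P]_w (f (lin_comb p w))%:E)%E.
    apply: eq_integral => w _; rewrite /f /p lin_combD lin_combZ /centered.
    by congr (1 + g _)%:E; ring.
  rewrite (ge0_integral_lin_comb gX pd)//.
  - apply: eq_integral => x _; rewrite /f pq /p meanD meanZ.
    by congr (1 + g _)%:E; ring.
  (* At [v] only [r] contributes, so the combination is nonzero and its law is normal. *)
  - by exists v; rewrite /p sv add0r mulf_neq0.
  - by move=> x; have := g1 (x - k * mean (mu := mu) r);
      rewrite ler_norml /f => /andP[? _]; lra.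
  - move=> x; apply: cvgD; first exact: cvg_cst.
    apply: (@continuous_comp _ _ _ (fun x => x - k * mean (mu := mu) r) g).
      by apply: cvgB; [exact: cvg_id|exact: cvg_cst].
    exact: cg.
have := key t erefl; rewrite -(key (- t)) ?sqrrN// ?ExD//; try exact: bounded_L1.
by move=> /addrI ->; apply: eq_Ex => w; rewrite mulNr.
Qed.

(** By product-to-sum formulas each product is half a difference of two functions exchanged by the
    reflection of [Ex_reflect]. *)
Lemma Ex_sin_prod r s (t : R) : bilin Sigma r s = 0 ->
    (exists v, s v = 0 /\ r v != 0) -> t != 0 ->
  Ex (fun w => sin (t * centered r w) * cos (lin_comb s w)) = 0 /\
  Ex (fun w => sin (t * centered r w) * sin (lin_comb s w)) = 0.
Proof.
move=> rs v0 t0.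
have mcomb k : measurable_fun setT (fun w => lin_comb s w + k * centered r w).
  apply: measurable_funD; first exact: measurable_lin_comb.
  by apply: measurable_funM => //; exact: measurable_centered.
have cos1 k : L1 (fun w => cos (lin_comb s w + k * centered r w)).
  exact: (bounded_L1 P (bounded_mfun_cos (mcomb k))).
have sin1 k : L1 (fun w => sin (lin_comb s w + k * centered r w)).
  exact: (bounded_L1 P (bounded_mfun_sin (mcomb k))).
have Ec := Ex_reflect (@continuous_cos R) (@cos_max R) rs v0 t0.
have Es := Ex_reflect (@continuous_sin R) (@sin_max R) rs v0 t0.
split.
- have -> : Ex (fun w => sin (t * centered r w) * cos (lin_comb s w))
      = Ex (fun w => 2^-1 * (sin (lin_comb s w + t * centered r w)
                             - sin (lin_comb s w + - t * centered r w))).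
    by apply: eq_Ex => w; rewrite mulNr !sinD cosN sinN; field.
  rewrite ExZ ?ExB ?Es//; last exact: L1B.
  have -> : Ex (fun w => sin (lin_comb s w + - t * centered r w))
      = Ex (fun w => sin (lin_comb s w - t * centered r w)).
    by apply: eq_Ex => w; rewrite mulNr.
  by rewrite subrr mulr0.
- have -> : Ex (fun w => sin (t * centered r w) * sin (lin_comb s w))
      = Ex (fun w => 2^-1 * (cos (lin_comb s w + - t * centered r w)
                             - cos (lin_comb s w + t * centered r w))).
    by apply: eq_Ex => w; rewrite mulNr !cosD cosN sinN; field.
  rewrite ExZ ?ExB ?Ec//; last exact: L1B.
  have -> : Ex (fun w => cos (lin_comb s w + - t * centered r w))
      = Ex (fun w => cos (lin_comb s w - t * centered r w)).
    by apply: eq_Ex => w; rewrite mulNr.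
  by rewrite subrr mulr0.
Qed.

Definition span_on Z : set (Omega -> R) :=
  [set S | exists2 s, forall v, v \notin Z -> s v = 0 & S = lin_comb s].

Lemma span_on_measurable Z S : span_on Z S -> measurable_fun setT S.
Proof. by move=> [s _ ->]; exact: measurable_lin_comb. Qed.

Lemma span_onD Z S T : span_on Z S -> span_on Z T ->
  span_on Z (fun w => S w + T w).
Proof.
move=> [s s0 ->] [t t0 ->]; exists (fun v => s v + t v).
  by move=> v vZ; rewrite s0// t0// addr0.
by apply/funext => w; rewrite lin_combD.
Qed.

Lemma span_onZ Z k S : span_on Z S -> span_on Z (fun w => k * S w).
Proof.
move=> [s s0 ->]; exists (fun v => k * s v).
  by move=> v vZ; rewrite s0// mulr0.
by apply/funext => w; rewrite lin_combZ.
Qed.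

Lemma span_on_var Z v : v \in Z -> span_on Z (X v).
Proof.
move=> vZ; exists (fun u => (u == v)%:R).
  by move=> u uZ; case: eqVneq uZ vZ => // -> /negP.
apply/funext => w; rewrite /lin_comb (bigD1 v)//= eqxx mul1r big1 ?addr0// => u.
by move=> /negPf->; rewrite mul0r.
Qed.

(** Take $t=1/(n+1)$ in [Ex_sin_prod], multiply by $n+1$ and pass to the limit, dominated by the
    absolute value of [centered r]. The vertex [u] is where [s] vanishes and [r] does not. *)
Lemma residual_trig_null Z u r : u \notin Z -> residual Sigma Z u r ->
  trig_null P (span_on Z) (centered r).
Proof.
move=> uZ [r1 r0 rZ]; have D1 := centered_L1 gX pd r.
have mD := measurable_centered (X := X) (mu := mu) r.
split=> // S [s s0 ->].
have rs : bilin Sigma r s = 0.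
  rewrite (@bilin_supp _ _ _ Z u)// ?s0 ?mulr0// => w.
  by rewrite !inE => /norP[_ /s0].
have v0 : exists v, s v = 0 /\ r v != 0.
  by exists u; rewrite s0// r1 oner_neq0.
have mS := measurable_lin_comb (X := X) s.
have bcos := bounded_mfun_cos mS; have bsin := bounded_mfun_sin mS.
have D1n := integrable_norm D1.
have msc (n : nat) : bounded_mfun (fun w => sin (n.+1%:R^-1 * centered r w)).
  by apply: bounded_mfun_sin; apply: measurable_funM.
have msc' n : L1 (fun w => n.+1%:R * sin (n.+1%:R^-1 * centered r w)).
  by apply: L1Z; exact: bounded_L1.
have sE n := Ex_sin_prod rs v0 (invr_neq0 (lt0r_neq0 (ltr0Sn R n))).
split.
- apply: (@Ex_cvg0 _ _ _ P (fun n w =>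
      (n.+1%:R * sin (n.+1%:R^-1 * centered r w)) * cos (lin_comb s w))
      _ (fun w => `|centered r w|) _ _ D1n _ _).2.
  + by move=> n; exact: (L1_measurable (L1M (msc' n) bcos)).
  + by move=> w; apply: cvgM; [exact: sin_scaling_cvg|exact: cvg_cst].
  + move=> n w; rewrite normrM (le_trans _ (sin_scaling_le n (centered r w)))//.
    by rewrite ler_piMr// cos_max.
  + move=> n; under eq_Ex do rewrite -mulrA.
    rewrite ExZ ?(sE n).1 ?mulr0//.
    exact: (L1M (bounded_L1 P (msc n)) bcos).
- apply: (@Ex_cvg0 _ _ _ P (fun n w =>
      (n.+1%:R * sin (n.+1%:R^-1 * centered r w)) * sin (lin_comb s w))
      _ (fun w => `|centered r w|) _ _ D1n _ _).2.
  + by move=> n; exact: (L1_measurable (L1M (msc' n) bsin)).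
  + by move=> w; apply: cvgM; [exact: sin_scaling_cvg|exact: cvg_cst].
  + move=> n w; rewrite normrM (le_trans _ (sin_scaling_le n (centered r w)))//.
    by rewrite ler_piMr// sin_max.
  + move=> n; under eq_Ex do rewrite -mulrA.
    rewrite ExZ ?(sE n).2 ?mulr0//.
    exact: (L1M (bounded_L1 P (msc n)) bsin).
Qed.

Lemma sigma_sub_sigma Z : sigma_algebra setT (sigma_sub X Z).
Proof. exact: smallest_sigma_algebra. Qed.

Lemma sigma_sub_setT Z : sigma_sub X Z setT.
Proof.
by have [+ _ _ _] := (sigma_algebraP (fun _ _ => @subsetT _ _)).1 (sigma_sub_sigma Z).
Qed.

Lemma sigma_sub_min Z (G : set (set Omega)) : sigma_algebra setT G ->
    (forall v (B : set R), v \in Z -> measurable B -> G (X v @^-1` B)) ->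
  sigma_sub X Z `<=` G.
Proof.
move=> sG GX; apply: smallest_sub => // _ [v vZ [B mB <-]].
by rewrite setTI; exact: GX.
Qed.

Lemma sigma_sub_measurable Z A : sigma_sub X Z A -> measurable A.
Proof.
apply: sigma_sub_min.
  split=> [|B mB|F mF]; [exact: measurable0|exact: measurableD|].
  exact: bigcupT_measurable.
move=> v B _ mB; rewrite -[X in measurable X]setTI; exact: measurable_funP.
Qed.

Lemma measurable_wrt_var Z v : v \in Z -> measurable_wrt (sigma_sub X Z) (X v).
Proof.
move=> vZ B mB; apply: sub_sigma_algebra; exists v => //.
by exists B => //; rewrite setTI.
Qed.

Lemma measurable_wrt_span Z k S : span_on Z S ->
  measurable_wrt (sigma_sub X Z) (fun w => k + S w).
Proof.
move=> [s s0 ->]; have sG := sigma_sub_sigma Z.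
apply/(measurable_wrtP _ sG); apply: measurable_funD => //.
apply: measurable_sum => v; have [vZ|/s0->] := boolP (v \in Z).
  apply: measurable_funM => //; apply/(measurable_wrtP _ sG).
  exact: measurable_wrt_var.
by under eq_fun do rewrite mul0r; exact: measurable_cst.
Qed.

(** The sets in [trig_algebra] form a sigma-algebra containing the generators of [sigma_sub X Z]. *)
Lemma residual_orth Z u r A : u \notin Z -> residual Sigma Z u r ->
  sigma_sub X Z A -> Ex (fun w => centered r w * \1_A w) = 0.
Proof.
move=> uZ ru ZA.
have mH := @span_on_measurable Z; have HD := @span_onD Z.
have HZ := @span_onZ Z.
have H0 : span_on Z (fun=> 0).
  exists (fun=> 0) => //; apply/funext => w.
  by rewrite /lin_comb big1// => v _; rewrite mul0r.
have sub : sigma_sub X Z `<=` trig_algebra P (span_on Z).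
  apply: sigma_sub_min; first exact: trig_algebra_sigma.
  move=> v B vZ mB; apply: trig_algebra_preimage => //.
  exact: span_on_var.
exact: (trig_null_indic H0 (residual_trig_null uZ ru) (sub _ ZA)).
Qed.

Lemma cond_indep_partial_cov Z u v : u != v -> u \notin Z -> v \notin Z ->
    cond_indep P (sigma_sub X [set u]) (sigma_sub X [set v]) (sigma_sub X Z) ->
  partial_cov Sigma Z u v = 0.
Proof.
move=> uv uZ vZ ci; rewrite partial_covC//.
have [r rv <-] := residual_exists pd vZ; have [r1 r0 rZ] := rv.
pose e x : R := (x == u)%:R.
pose s x : R := (x == v)%:R - r x.
have sZ x : x \notin Z -> s x = 0.
  move=> xZ; rewrite /s; have [->|xv] := eqVneq x v; first by rewrite r1 subrr.
  by rewrite r0 ?subrr// !inE negb_or xv.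
(* The regression of [X v] on the variables of [Z], with its constant term, so that [X v - M] is the
   centered residual. *)
pose M w := mean (mu := mu) r + lin_comb s w.
have ME w : X v w - M w = centered r w.
  rewrite /M /centered /lin_comb /s; under eq_bigr do rewrite mulrBl.
  rewrite sumrB (bigD1 v)//= eqxx mul1r big1 ?addr0; first by ring.
  by move=> x /negPf->; rewrite mul0r.
have [Du1 DuE] := centered_prod gX pd r e.
have D1 := centered_L1 gX pd r.
have eE w : centered e w = X u w - mu u.
  rewrite /centered /lin_comb /mean (bigD1 u)//= /e eqxx mul1r big1; last first.
    by move=> x /negPf->; rewrite mul0r.
  rewrite (bigD1 u)//= eqxx mul1r big1; last first.
    by move=> x /negPf->; rewrite mul0r.
  by rewrite !addr0.
have one : L1 (fun=> 1) by exact/bounded_L1/bounded_mfun_cst.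
have X1 x : L1 (X x).
  pose ex y : R := (y == x)%:R.
  have xE w : X x w = centered ex w + mean (mu := mu) ex * 1.
    rewrite /centered /lin_comb (bigD1 x)//= /ex eqxx mul1r big1; last first.
      by move=> y /negPf->; rewrite mul0r.
    by ring.
  have -> : (X x : Omega -> R) = fun w => centered ex w + mean (mu := mu) ex * 1.
    exact/funext.
  exact: (L1D (centered_L1 gX pd ex) (L1Z _ one)).
have M1 : L1 M.
  have -> : M = fun w => X v w - centered r w.
    by apply/funext => w; rewrite -ME subKr.
  exact: (L1B (X1 v) D1).
have DX : (fun w => centered r w * X u w)
    = fun w => centered r w * centered e w + mu u * centered r w.
  by apply/funext => w; rewrite eE; ring.
have DX1 : L1 (fun w => centered r w * X u w).
  by rewrite DX; exact: (L1D Du1 (L1Z _ D1)).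
(* The residual has mean zero, so [X u] may be replaced by its centered version [centered e]. *)
have E0 : Ex (centered r) = 0.
  have := @residual_orth Z v r setT vZ rv.
  under eq_Ex do rewrite indicE in_setT mulr1.
  by apply; exact: sigma_sub_setT.
have : Ex (fun w => centered r w * X u w) = 0.
  have VMG C : sigma_sub X Z C -> Ex (fun w => (X v w - M w) * \1_C w) = 0.
    by under eq_Ex do rewrite ME; exact: residual_orth rv.
  have DE : (fun w => centered r w * X u w) = fun w => (X v w - M w) * X u w.
    by apply/funext => w; rewrite ME.
  rewrite DE in DX1 *.
  have uu := finset.set11 u.
  have vv := finset.set11 v.
  have sM : span_on Z (lin_comb s) by exists s.
  exact: (cond_indep_orth (sigma_sub_sigma Z) (@sigma_sub_measurable _)
    (@sigma_sub_measurable _) (@sigma_sub_measurable _) (@sigma_sub_setT _) ci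
    (measurable_wrt_var uu) (measurable_wrt_var vv) (measurable_wrt_span _ sM)
    (X1 v) M1 DX1 VMG).
rewrite DX ExD ?DuE ?ExZ ?E0 ?mulr0 ?addr0//; last exact: L1Z.
move=> /eqP; rewrite mulf_eq0 (gt_eqF kappa_gt0) orbF => /eqP <-.
rewrite /bilin (bigD1 u)//= /e eqxx mulr1 big1 ?addr0//.
by move=> x /negPf->; rewrite mulr0.
Qed.

End GaussianMarkov.

Theorem corollary2 (R : realType) (d : measure_display)
    (Omega : measurableType d) (P : probability Omega R)
    (V : finType) (e : rel V) (X : V -> {RV P >-> R})
    (mu : V -> R) (Sigma : V -> V -> R)
    (treeG : gaussian_tree e X mu Sigma)
    (a c : V) (neq_ac : a != c) (Z1 Z2 : {set V})
    (aZ1 : a \notin Z1) (cZ1 : c \notin Z1)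
    (aZ2 : a \notin Z2) (cZ2 : c \notin Z2)
    (meets : forall z2, z2 \in Z2 ->
       path_meets e Z1 a z2 /\ path_meets e Z1 c z2) :
  sq_partial_corr Sigma a c Z1 <= sq_partial_corr Sigma a c Z2.
Proof.
have pd := gt_posdef treeG.
apply: (sq_partial_corr_sep_le (gt_tree treeG) pd) => // u v Z uv uZ vZ uZv.
apply: (cond_indep_partial_cov (gt_gaussian treeG) pd uv uZ vZ).
(* The Markov property is applied to the singletons of [u] and [v]. *)
apply: (gt_markov treeG).
- by apply/eqP; rewrite setI_eq0 disjoints1 inE.
- by apply/eqP; rewrite setI_eq0 disjoints1.
- by apply/eqP; rewrite setI_eq0 disjoints1.
- by move=> x y; rewrite !inE => /eqP-> /eqP->.
Qed.
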